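(* There exists a separable, simply connected surface $M$ such that for every compact subset $K\subset M$, the surface $M\setminus K$ does not admit a foliation (of dimension $1$).
   Context: Manifolds are Hausdorff, locally Euclidean spaces (not assumed metrisable or second countable), connected and without boundary unless otherwise indicated; an open subset such as $M\setminus K$ is treated as a (possibly disconnected) manifold. A surface is a $2$-dimensional manifold. A foliation (always of dimension $1$, topological) on an $n$-manifold $M$ is given by a maximal atlas of foliated charts $\varphi:U\to\mathbb R\times\mathbb R^{n-1}$ (homeomorphisms from open sets $U$ covering $M$ onto open boxes) whose coordinate changes are locally of the form $(x,y)\mapsto(f(x,y),g(y))$ with $y\in\mathbb R^{n-1}$. *)

(* Defs.v *)
From HB Require Import structures.
From mathcomp Require Import all_boot all_order all_algebra.
From mathcomp Require Import all_classical all_reals topology normedtype.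

Set Implicit Arguments.
Unset Strict Implicit.
Unset Printing Implicit Defensive.

Import Order.TTheory GRing.Theory Num.Theory.
Import numFieldNormedType.Exports.

Local Open Scope classical_set_scope.
Local Open Scope ring_scope.

(* f restricts to a homeomorphism from A onto B; the values of f outside A are
   irrelevant. *)
Definition homeo_on (T U : topologicalType) (A : set T) (B : set U)
    (f : T -> U) : Prop :=
  [/\ set_bij A B f, {within A, continuous f}
    & exists2 g : U -> T, {within B, continuous g} & {in A, cancel f g}].

Definition separable (T : topologicalType) : Prop :=
  exists2 D : set T, countable D & dense D.

Definition path_connected (R : realType) (T : topologicalType) : Prop :=
  forall x y : T, exists c : R -> T,
    [/\ {within `[0, 1], continuous c}, c 0 = x & c 1 = y].

(* Every loop is homotopic to a constant loop relative to its endpoints; in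
   h (s, t), s is the homotopy parameter and t the loop parameter. *)
Definition simply_connected (R : realType) (T : topologicalType) : Prop :=
  path_connected R T /\
  forall c : R -> T, {within `[0, 1], continuous c} -> c 0 = c 1 ->
    exists h : R * R -> T,
      [/\ {within `[0, 1] `*` `[0, 1], continuous h},
          forall t, t \in `[0, 1] -> h (0, t) = c t,
          forall t, t \in `[0, 1] -> h (1, t) = c 0
        & forall s, s \in `[0, 1] -> h (s, 0) = c 0 /\ h (s, 1) = c 0].

Definition locally_euclidean (R : realType) (n : nat) (M : topologicalType)
    : Prop :=
  forall x : M, exists (U : set M) (V : set 'rV[R]_n) (f : M -> 'rV[R]_n),
    [/\ open U, U x, open V & homeo_on U V f].

Definition manifold (R : realType) (n : nat) (M : topologicalType) : Prop :=
  [/\ hausdorff_space M, connected [set: M] & locally_euclidean R n M].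

Definition surface (R : realType) (M : topologicalType) : Prop :=
  manifold R 2 M.

Section Foliation.
Variables (R : realType) (q : nat) (M : topologicalType).

Local Notation E := (R * 'rV[R]_q)%type.

(* A nonempty product of open intervals, bounded or not. *)
Definition open_box (B : set E) : Prop :=
  exists (I : set R) (J : 'I_q -> set R),
    [/\ open I /\ (forall i, open (J i)),
        is_interval I /\ (forall i, is_interval (J i)),
        B !=set0
      & B = [set z : E | I z.1 /\ forall i, J i (z.2 ord0 i)]].

(* A chart is the pair of its domain and a total function, of which only the
   restriction to the domain matters. *)
Definition foliated_chart (c : set M * (M -> E)) : Prop :=
  open c.1 /\ exists2 B : set E, open_box B & homeo_on c.1 B c.2.

(* The coordinate change z |-> d (c^-1 z) is locally of the form
   (x, y) |-> (f (x, y), g y); the equation is written at the points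
   p = c^-1 z of the overlap of the domains. *)
Definition foliated_change (c d : set M * (M -> E)) : Prop :=
  forall p0, (c.1 `&` d.1) p0 ->
    exists (f : E -> R) (g : 'rV[R]_q -> 'rV[R]_q),
      \forall p \near p0, d.2 p = (f (c.2 p), g (c.2 p).2).

(* F is a foliation of dimension 1 and codimension q on the open subset W, seen
   as a manifold of dimension q.+1. The charts of W are those charts of M whose
   domain is included in W. *)
Definition foliation1 (W : set M) (F : set (set M * (M -> E))) : Prop :=
  [/\ forall c, F c -> foliated_chart c /\ c.1 `<=` W,
      forall p, W p -> exists2 c, F c & c.1 p,
      forall c d, F c -> F d -> foliated_change c d
    & forall c, foliated_chart c -> c.1 `<=` W ->
        (forall d, F d -> foliated_change c d /\ foliated_change d c) -> F c].

End Foliation.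

Definition admits_foliation1 (R : realType) (q : nat) (M : topologicalType)
    (W : set M) : Prop :=
  exists F, @foliation1 R q M W F.

(* Main.v *)
Require Import Defs.
From HB Require Import structures.
From mathcomp Require Import all_boot all_order all_algebra.
From mathcomp Require Import all_classical all_reals topology normedtype.
From mathcomp Require Import sequences derive realfun exp trigo.
From mathcomp Require Import ring lra.

Set Implicit Arguments.
Unset Strict Implicit.
Unset Printing Implicit Defensive.

Import Order.TTheory GRing.Theory Num.Theory.
Import numFieldNormedType.Exports.

Local Open Scope classical_set_scope.
Local Open Scope ring_scope.

(** The surface is a Moore surface whose seams are glued in with twists.

    Start from the plane of points (m, w), thought of as the open half plane of
    the points (m, y) with y = exp (- w). Folding the boundary line y = 0 of the
    closed half plane by (m, 0) ~ (- m, 0), which complex squaring [csquare]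
    does, turns it into the whole plane R^2 and the line into a ray, the seam.
    For each binary sequence x a copy of this ray is added to the open half
    plane, along a homeomorphism [weld x] of the open half plane with itself.
    All the charts [chart x] are therefore planes, and any two of them meet
    exactly in the open half plane.

    [weld x] is made of two maps. The shear by [drift x] pulls different seams
    apart: the drifts of two sequences diverge from each other when w tends to
    infinity ([drift_apart]), hence the surface is Hausdorff. The map [twists]
    rotates the k-th of a sequence of disjoint discs, if x k is true, by an
    angle which grows from 0 on the boundary to k at the centre. These discs
    have a fixed width and a height of at most exp (- k), and shrink to a
    segment of the seam around the point m = 1. Two sequences that first differ
    at k are welded in the same way near the k-th disc except for its twist
    ([weld_agree]).

    The surface is separable because the half plane is dense in it. It is simply
    connected because each point is joined to a base point by a path that stays
    in every chart containing the point ([spoke]): short pieces of a loop are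
    contracted along these paths within one chart, and the contractions agree at
    the common ends ([fill_chart], [fill_trans]).

    Suppose that the complement of a compact set is foliated. The compact set
    meets finitely many seams. At the point m = 1 of any other seam take a
    foliated chart. A plaque that returns to the axis m = 1 very close to the
    seam returns close to where it left it, so that it cannot have gone far
    sideways in between ([adapted], [adapted_exists]). Within a very flat disc,
    a plaque that crosses the annulus of radii r / 2 and r thus meets at most
    one half of the axis of the disc ([plaque_half_avoiding]), and its direction
    from the centre stays within one turn. There are uncountably many sequences,
    so two of them, first differing at a large k, admit the same constants.
    One plaque through the centre of the k-th disc, seen in both charts, crosses
    the annulus along two curves that differ by a rotation whose angle changes
    by k r / 2, at least two turns. This is impossible
    ([twisted_not_half_avoiding], [twist_conflict]). *)

(** * Twists and drifts of the plane *)
Section PlanarMaps.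
Variable R : realType.
Implicit Types (P Z z : R * R) (x : nat -> bool) (k n : nat) (t w e : R).

Lemma continuous_pair (T U V : topologicalType) (u : T -> U) (v : T -> V) (p : T) :
  {for p, continuous u} -> {for p, continuous v} ->
  {for p, continuous (fun q => (u q, v q))}.
Proof. by move=> cu cv; exact: cvg_pair. Qed.

Lemma near_continuous (T U : topologicalType) (u v : T -> U) (p : T) :
  {near p, u =1 v} -> {for p, continuous v} -> {for p, continuous u}.
Proof.
move=> uv cv; have uvp : u p = v p := nbhs_singleton uv.
have : u q @[q --> p] --> v p.
  apply: cvg_trans cv; apply: near_eq_cvg.
  by apply: filterS uv => q ->.
by rewrite -uvp.
Qed.

Definition enorm z : R := Num.sqrt (z.1 ^+ 2 + z.2 ^+ 2).

Definition rot t z : R * R :=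
  (z.1 * cos t - z.2 * sin t, z.1 * sin t + z.2 * cos t).

Lemma enorm_ge0 z : 0 <= enorm z. Proof. exact: sqrtr_ge0. Qed.

Lemma sqr_enorm z : enorm z ^+ 2 = z.1 ^+ 2 + z.2 ^+ 2.
Proof. by rewrite sqr_sqrtr // addr_ge0 // sqr_ge0. Qed.

Lemma normr1_enorm z : `|z.1| <= enorm z.
Proof. by rewrite -sqrtr_sqr ler_wsqrtr // lerDl sqr_ge0. Qed.

Lemma normr2_enorm z : `|z.2| <= enorm z.
Proof. by rewrite -sqrtr_sqr ler_wsqrtr // lerDr sqr_ge0. Qed.

Lemma rot0 z : rot 0 z = z.
Proof. by case: z => a b; rewrite /rot cos0 sin0 /=; congr (_, _); ring. Qed.

Lemma rotD t u z : rot t (rot u z) = rot (t + u) z.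
Proof. by rewrite /rot cosD sinD /=; congr (_, _); ring. Qed.

Lemma enorm_rot t z : enorm (rot t z) = enorm z.
Proof.
congr Num.sqrt; rewrite /rot /=.
have := cos2Dsin2 t; set c := cos t; set s := sin t => cs.
have -> : (z.1 * c - z.2 * s) ^+ 2 + (z.1 * s + z.2 * c) ^+ 2 =
  (z.1 ^+ 2 + z.2 ^+ 2) * (c ^+ 2 + s ^+ 2) by ring.
by rewrite cs mulr1.
Qed.

(** Coordinates in which the k-th disc, of centre (1, k + 1/2), is the unit
    disc. It is inscribed in the strip k <= w <= k + 1, so distinct discs have
    disjoint interiors. *)
Definition cell k P : R * R := (P.1 - 1, 2 * P.2 - 2 * k%:R - 1).
Definition uncell k z : R * R := (1 + z.1, (z.2 + 2 * k%:R + 1) / 2).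

Lemma cellK k : cancel (cell k) (uncell k).
Proof. by case=> a b; rewrite /cell /uncell /=; congr (_, _); field. Qed.

Lemma uncellK k : cancel (uncell k) (cell k).
Proof. by case=> a b; rewrite /cell /uncell /=; congr (_, _); field. Qed.

(** The rotation vanishes on the boundary of the disc and grows to k at its
    centre. Its variation over a fixed annulus thus tends to infinity with k. *)
Definition angle k z : R := k%:R * Num.max 0 (1 - enorm z).

Definition twist k t P : R * R :=
  uncell k (rot (t * angle k (cell k P)) (cell k P)).

Lemma twist_out k t P : 1 <= enorm (cell k P) -> twist k t P = P.
Proof.
move=> h; rewrite /twist /angle max_l ?subr_le0 //.
by rewrite !mulr0 rot0 cellK.
Qed.

Lemma twist0 t P : twist 0 t P = P.
Proof. by rewrite /twist /angle mul0r mulr0 rot0 cellK. Qed.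

Lemma twist_still k P : twist k 0 P = P.
Proof. by rewrite /twist mul0r rot0 cellK. Qed.

Lemma enorm_twist k t P : enorm (cell k (twist k t P)) = enorm (cell k P).
Proof. by rewrite uncellK enorm_rot. Qed.

Lemma twistK k t P : twist k (- t) (twist k t P) = P.
Proof.
rewrite /twist !uncellK rotD /angle enorm_rot -mulrDl addNr mul0r rot0.
by rewrite cellK.
Qed.

Lemma cell_ge1 k P : ~~ (k%:R < P.2 < k.+1%:R) -> 1 <= enorm (cell k P).
Proof.
move=> h; apply: le_trans (normr2_enorm _); rewrite /cell /=.
rewrite ler_normr; move: h; rewrite -[k.+1]addn1 natrD negb_and -!leNgt.
by case/orP => h; apply/orP; [right|left]; lra.
Qed.

Lemma cell_lt1 k P : enorm (cell k P) < 1 -> k%:R < P.2 < k.+1%:R.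
Proof. by apply: contraTT => /cell_ge1; rewrite leNgt. Qed.

Lemma twist_band k t P : k%:R <= P.2 < k.+1%:R ->
  k%:R <= (twist k t P).2 < k.+1%:R.
Proof.
move=> h; have [h1|h1] := leP 1 (enorm (cell k P)); first by rewrite twist_out.
by move: h1; rewrite -(enorm_twist k t) => /cell_lt1 /andP[/ltW -> ->].
Qed.

Lemma twist_near k t P : `|(twist k t P).1 - P.1| <= 2.
Proof.
have [h1|h1] := leP 1 (enorm (cell k P)).
  by rewrite twist_out // subrr normr0.
have hP := le_lt_trans (normr1_enorm _) h1.
have := h1; rewrite -(enorm_twist k t) => h2.
have := le_lt_trans (normr1_enorm _) h2.
have E Q : (cell k Q).1 = Q.1 - 1 by [].
move: hP; rewrite !E ler_norml !ltr_norml.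
by move=> /andP[? ?] /andP[? ?]; apply/andP; split; lra.
Qed.

Lemma continuous_enorm_pair (T : topologicalType) (u v : T -> R) (p : T) :
  {for p, continuous u} -> {for p, continuous v} ->
  {for p, continuous (fun q => enorm (u q, v q))}.
Proof.
move=> cu cv.
apply: (continuous_comp (f := fun q => u q ^+ 2 + v q ^+ 2)); last first.
  exact: sqrt_continuous.
by rewrite /continuous_at; apply: cvgD; apply: cvgM.
Qed.

Lemma continuous_cell k P : {for P, continuous (cell k)}.
Proof.
apply: continuous_pair; rewrite /continuous_at.
  by apply: cvgB; [exact: cvg_fst|exact: cvg_cst].
apply: cvgB; last exact: cvg_cst.
apply: cvgB; last exact: cvg_cst.
by apply: cvgM; [exact: cvg_cst|exact: cvg_snd].
Qed.

Lemma continuous_rot (T : topologicalType) (u : T -> R) (v : T -> R * R) p :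
  {for p, continuous u} -> {for p, continuous v} ->
  {for p, continuous (fun q => rot (u q) (v q))}.
Proof.
move=> cu cv.
have c1 : {for p, continuous (fun q => (v q).1)}.
  by apply: (continuous_comp cv); exact: cvg_fst.
have c2 : {for p, continuous (fun q => (v q).2)}.
  by apply: (continuous_comp cv); exact: cvg_snd.
have cc : {for p, continuous (fun q => cos (u q))}.
  by apply: (continuous_comp cu); exact: continuous_cos.
have cs : {for p, continuous (fun q => sin (u q))}.
  by apply: (continuous_comp cu); exact: continuous_sin.
by apply: continuous_pair; rewrite /continuous_at;
  [apply: cvgB|apply: cvgD]; apply: cvgM.
Qed.

Lemma continuous_angle k z : {for z, continuous (angle k)}.
Proof.
have ce : {for z, continuous enorm}.
  have -> : enorm = (fun q => enorm (q.1, q.2)).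
    by apply/funext => -[].
  by apply: continuous_enorm_pair; [exact: cvg_fst|exact: cvg_snd].
rewrite /continuous_at /angle; apply: cvgM; first exact: cvg_cst.
apply: (continuous_max (f := fun=> 0) (g := fun z => 1 - enorm z)).
  exact: cvg_cst.
by rewrite /continuous_at; apply: cvgB => //; exact: cvg_cst.
Qed.

Lemma continuous_twist k t : continuous (twist k t).
Proof.
move=> P; have cc := @continuous_cell k P.
have cr : {for P, continuous
    (fun Q => rot (t * angle k (cell k Q)) (cell k Q))}.
  apply: continuous_rot => //; rewrite /continuous_at.
  apply: cvgM; first exact: cvg_cst.
  by apply: (continuous_comp cc); exact: continuous_angle.
apply: (continuous_comp cr); apply: continuous_pair; rewrite /continuous_at.
  by apply: cvgD; [exact: cvg_cst|exact: cvg_fst].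
apply: cvgM; last exact: cvg_cst.
apply: cvgD; last exact: cvg_cst.
by apply: cvgD; [exact: cvg_snd|exact: cvg_cst].
Qed.

(** Distinct discs lie in distinct strips k <= w <= k + 1, so the only twist
    that can move P is that of the strip of P. Points with w < 0 are in no disc.
    The sign e makes the inverse an instance of the same formula. *)
Definition twists e x P : R * R :=
  twist (Num.truncn P.2) (e * (x (Num.truncn P.2))%:R) P.

Lemma twist_truncn k t P :
  twist k t P <> P -> Num.truncn P.2 = k.
Proof.
move=> h; apply: truncn_def; have [h1|/cell_lt1 /andP[/ltW -> ->]//] :=
  leP 1 (enorm (cell k P)).
by rewrite twist_out in h.
Qed.

Lemma truncn_twist k t P : Num.truncn (twist k t P).2 = Num.truncn P.2.
Proof.
have [->//|/eqP h] := eqVneq (twist k t P) P.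
rewrite (twist_truncn h); apply: (@twist_truncn k (- t)).
by rewrite twistK; apply/nesym.
Qed.

Lemma twistsK e x P : twists (- e) x (twists e x P) = P.
Proof. by rewrite {1}/twists truncn_twist mulNr twistK. Qed.

Lemma twists_near e x P : `|(twists e x P).1 - P.1| <= 2.
Proof. exact: twist_near. Qed.

Lemma truncn_twists e x P : Num.truncn (twists e x P).2 = Num.truncn P.2.
Proof. exact: truncn_twist. Qed.

Lemma twists_cell e x k P : k%:R <= P.2 < k.+1%:R ->
  twists e x P = twist k (e * (x k)%:R) P.
Proof. by move=> /truncn_def h; rewrite /twists h. Qed.

(** On the line w = n that separates two strips, both adjacent formulas are the
    identity; near such a point the map is the composite of the two twists. *)
Lemma continuous_twists e x : continuous (twists e x).
Proof.
move=> P0; set n := Num.truncn P0.2.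
pose a k := e * (x k)%:R.
apply: (@near_continuous _ _ _ (twist n (a n) \o twist n.-1 (a n.-1))); last first.
  by apply: continuous_comp; exact: continuous_twist.
have c2 : (fun P : R * R => P.2) @ P0 --> P0.2 by exact: cvg_snd.
have up : \forall P \near P0, P.2 < n.+1%:R.
  by apply: (cvgr_lt _ c2); rewrite -truncn_le_nat.
have lo : \forall P \near P0, (0 < n)%N -> n.-1%:R < P.2.
  case: (posnP n) => [->|n0]; first by near=> P.
  have : n.-1%:R < P0.2.
    apply: (@lt_le_trans _ _ n%:R); first by rewrite ltr_nat prednK.
    rewrite /n truncn_le; move: n0; rewrite /n truncn_gt0 => /(le_trans _)-> //.
  by move=> /(cvgr_gt _ c2); apply: filterS.
near=> P => /=.
have Pup : P.2 < n.+1%:R by near: P.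
have Plo : (0 < n)%N -> n.-1%:R < P.2 by near: P.
have [nP|Pn] := leP n%:R P.2.
  rewrite (@twists_cell _ _ n) ?nP //; congr twist.
  case: (posnP n) => [->|n0]; first by rewrite twist0.
  by rewrite twist_out // cell_ge1 // prednK // negb_and -!leNgt nP orbT.
case: (posnP n) Pn Plo => [n0|n0] Pn Plo.
  rewrite n0 !twist0 /twists.
  suff -> : Num.truncn P.2 = 0%N by rewrite twist0.
  by apply/truncn0Pn; move: Pn; rewrite n0 -ltNge => /lt_trans; apply.
have hb : n.-1%:R <= P.2 < n.-1.+1%:R by rewrite ltW ?Plo // prednK.
rewrite (@twists_cell _ _ n.-1) // [RHS]twist_out // cell_ge1 //.
have := twist_band (a n.-1) hb.
by rewrite prednK // negb_and -!leNgt => /andP[_ /ltW ->].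
Unshelve. all: by end_near.
Qed.

Definition drift_sum x n w : R :=
  \sum_(0 <= j < n) (x j)%:R * 4^-1 ^+ j * Num.max 0 (w - j.+1%:R).

(** Summands with w <= j + 1 vanish, so this is a locally finite sum over all j.
    *)
Definition drift x w : R := drift_sum x (Num.truncn w).+1 w.

Lemma drift_sum_stable x n m w : (n <= m)%N -> w <= n.+1%:R ->
  drift_sum x m w = drift_sum x n w.
Proof.
move=> nm wn; rewrite /drift_sum (big_cat_nat _ nm) //=.
rewrite [X in _ + X]big_nat_cond [X in _ + X]big1 ?addr0 // => j.
rewrite andbT => /andP[nj _]; rewrite max_l ?mulr0 // subr_le0.
by apply: le_trans wn _; rewrite ler_nat.
Qed.

Lemma driftE x n w : w <= n.+1%:R -> drift x w = drift_sum x n w.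
Proof.
move=> wn; rewrite /drift; set m := (Num.truncn w).+1.
have wm : w <= m.+1%:R.
  by apply: ltW; apply: (lt_le_trans (truncnS_gt w)); rewrite ler_nat.
have [nm|/ltnW mn] := leqP n m; first exact: drift_sum_stable.
by rewrite (drift_sum_stable _ mn).
Qed.

Lemma continuous_drift x : continuous (drift x).
Proof.
move=> w0; set n := (Num.truncn w0).
apply: (@near_continuous _ _ _ (drift_sum x n)).
  have : \forall w \near w0, w < n.+1%:R.
    by apply: lt_nbhsl => //; rewrite -truncn_le_nat.
  by apply: filterS => w wn; rewrite (driftE _ (ltW wn)).
elim: n => [|n IH].
  have -> : drift_sum x 0 = fun=> 0.
    by apply/funext => w; rewrite /drift_sum big_nil.
  exact: cvg_cst.
have -> : drift_sum x n.+1 = fun w => drift_sum x n w +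
    (x n)%:R * 4^-1 ^+ n * Num.max 0 (w - n.+1%:R).
  by apply/funext => w; rewrite /drift_sum big_nat_recr.
rewrite /continuous_at; apply: cvgD => //.
apply: cvgM; first exact: cvg_cst.
apply: (continuous_max (f := fun=> 0) (g := fun w => w - n.+1%:R)).
  exact: cvg_cst.
by rewrite /continuous_at; apply: cvgB; [exact: cvg_id|exact: cvg_cst].
Qed.

Lemma drift_agree x x' k w : (forall j, (j < k)%N -> x j = x' j) ->
  w <= k.+1%:R -> drift x w = drift x' w.
Proof.
move=> xx' wk; rewrite !(driftE _ wk) /drift_sum.
by apply: eq_big_nat => j /andP[_ jk]; rewrite xx'.
Qed.

(** With ratio 1/4, the first summand in which the two sequences differ
    outweighs all the following ones together. *)
Lemma drift_apart x x' k w : (forall j, (j < k)%N -> x j = x' j) ->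
  x k != x' k -> k.+1%:R <= w ->
  4^-1 ^+ k / 2 * (w - k.+1%:R) <= `|drift x w - drift x' w|.
Proof.
move=> xx' xk kw; set v := w - k.+1%:R.
have v0 : 0 <= v by rewrite subr_ge0.
pose eps j : R := (x j)%:R - (x' j)%:R.
have eps1 j : `|eps j| <= 1.
  by rewrite /eps; case: (x j); case: (x' j);
    rewrite ?subrr ?sub0r ?subr0 ?normrN ?normr1 ?normr0.
have epsk : `|eps k| = 1.
  by move: xk; rewrite /eps; case: (x k); case: (x' k) => // _;
    rewrite ?sub0r ?subr0 ?normrN ?normr1.
pose D n := drift_sum x n w - drift_sum x' n w.
have DS n : D n.+1 = D n + eps n * 4^-1 ^+ n * Num.max 0 (w - n.+1%:R).
  by rewrite /D /drift_sum !big_nat_recr //= /eps; ring.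
have Dk : D k = 0.
  apply/eqP; rewrite subr_eq0; apply/eqP.
  by apply: eq_big_nat => j /andP[_ jk]; rewrite xx'.
(* The geometric bound on the summands from k + 1 to k + n. *)
have key n : `|D (k.+1 + n)%N - eps k * 4^-1 ^+ k * v| <=
    (4^-1 ^+ k - 4^-1 ^+ (k + n)) / 2 * v.
  elim: n => [|n IH].
    rewrite !addn0 DS Dk max_r // add0r subrr normr0.
    by rewrite subrr mul0r mul0r.
  rewrite addnS DS -addrAC.
  apply: (le_trans (ler_normD _ _)).
  have h2 : `|eps (k.+1 + n)%N * 4^-1 ^+ (k.+1 + n) *
      Num.max 0 (w - (k.+1 + n).+1%:R)| <= 4^-1 ^+ (k.+1 + n) * v.
    rewrite -mulrA normrM -[leRHS]mul1r.
    have p4 : 0 <= 4^-1 ^+ (k.+1 + n) :> R by apply: exprn_ge0; rewrite invr_ge0.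
    apply: ler_pM => //.
    rewrite ger0_norm; last by apply: mulr_ge0 => //; rewrite le_max lexx.
    apply: ler_wpM2l => //; rewrite ge_max v0 /= /v.
    by apply: lerB => //; rewrite ler_nat -addnS leq_addr.
  apply: (le_trans (lerD IH h2)).
  rewrite addSn addnS !exprS; set q := 4^-1 ^+ (k + n); set q' := 4^-1 ^+ k.
  have q0 : 0 <= q * v.
    by apply: mulr_ge0 => //; apply: exprn_ge0; rewrite invr_ge0.
  have -> : (q' - q) / 2 * v + 4^-1 * q * v = (q' * v) / 2 - (q * v) / 4 by field.
  have -> : (q' - 4^-1 * q) / 2 * v = (q' * v) / 2 - (q * v) / 8 by field.
  lra.
have [n [kn wn]] : exists n, (k < n)%N /\ w <= n.+1%:R.
  exists (maxn k.+1 (Num.truncn w)); split; first by rewrite leq_max leqnn.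
  apply: ltW; apply: (lt_le_trans (truncnS_gt w)).
  by rewrite ler_nat ltnS leq_maxr.
rewrite !(driftE _ wn) -/(D n).
have := key (n - k.+1)%N; rewrite subnKC // => h.
have h3 : `|eps k * 4^-1 ^+ k * v| = 4^-1 ^+ k * v.
  rewrite !normrM epsk mul1r !ger0_norm //.
  by apply: exprn_ge0; rewrite invr_ge0.
have := lerB_dist (eps k * 4^-1 ^+ k * v) (D n).
rewrite h3 distrC => /le_trans /(_ h).
set q := 4^-1 ^+ (k + _); set q' := 4^-1 ^+ k.
have q0 : 0 <= q * v.
  by apply: mulr_ge0 => //; apply: exprn_ge0; rewrite invr_ge0.
have -> : (q' - q) / 2 * v = (q' * v) / 2 - (q * v) / 2 by field.
have -> : q' / 2 * v = (q' * v) / 2 by field.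
lra.
Qed.

Definition weld x P : R * R :=
  let Q := twists 1 x P in (Q.1 + drift x Q.2, Q.2).
Definition unweld x Z : R * R := twists (- 1) x (Z.1 - drift x Z.2, Z.2).

Lemma weldK x : cancel (weld x) (unweld x).
Proof.
move=> P; rewrite -[RHS](twistsK 1 x); rewrite /unweld; congr twists.
by rewrite /weld; case: (twists 1 x P) => a b /=; rewrite addrK.
Qed.

Lemma unweldK x : cancel (unweld x) (weld x).
Proof.
move=> Z; rewrite /weld /unweld.
by rewrite -[X in twists X]opprK twistsK /= subrK -surjective_pairing.
Qed.

Lemma continuous_weld x : continuous (weld x).
Proof.
move=> P; have ct := @continuous_twists 1 x P.
apply: (continuous_comp (g := fun Q => (Q.1 + drift x Q.2, Q.2)) ct).
apply: continuous_pair; last exact: cvg_snd.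
rewrite /continuous_at; apply: cvgD; first exact: cvg_fst.
apply: (continuous_comp (f := snd)); first exact: cvg_snd.
exact: continuous_drift.
Qed.

Lemma continuous_unweld x : continuous (unweld x).
Proof.
move=> Z; apply: (continuous_comp (f := fun Z => (Z.1 - drift x Z.2, Z.2)));
  last exact: continuous_twists.
apply: continuous_pair; last exact: cvg_snd.
rewrite /continuous_at; apply: cvgB; first exact: cvg_fst.
apply: (continuous_comp (f := snd)); first exact: cvg_snd.
exact: continuous_drift.
Qed.

(** Up to w = k + 1 the drift only sees the terms of index less than k, and
    within the k-th strip only the k-th twist acts. *)
Lemma weld_agree x x' k P : (forall j, (j < k)%N -> x j = x' j) ->
  x k = true -> x' k = false -> k%:R <= P.2 < k.+1%:R ->
  weld x P = weld x' (twist k 1 P).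
Proof.
move=> xx' xk x'k hP; have hT := twist_band 1 hP.
rewrite /weld (twists_cell _ _ hP) (twists_cell _ _ hT) xk x'k mulr1 mulr0.
rewrite twist_still; congr (_ + _, _).
by apply: drift_agree xx' _; apply: ltW; case/andP: hT.
Qed.

End PlanarMaps.

(** * Folding the half plane by complex squaring *)
Section Fold.
Variable R : realType.
Implicit Types (P v : R * R).

(** The square of the complex number with coordinates P. *)
Definition csquare P : R * R := (P.1 ^+ 2 - P.2 ^+ 2, 2 * P.1 * P.2).
(** The homeomorphism from the plane of points (m, w) onto the plane slit along
    the half-line [on_slit]; its inverse is [slit_coord]. *)
Definition slit_point P : R * R := csquare (P.1, expR (- P.2)).
Definition on_slit v : bool := (v.2 == 0) && (0 <= v.1).
(** The imaginary part of the square root in the upper half plane. *)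
Definition height v : R := Num.sqrt ((enorm v - v.1) / 2).
Definition slit_coord v : R * R := (v.2 / (2 * height v), - ln (height v)).

Lemma le_enorm v : v.1 <= enorm v.
Proof. exact: le_trans (ler_norm _) (normr1_enorm _). Qed.

Lemma height_gt0 v : ~~ on_slit v -> 0 < height v.
Proof.
move=> vL; rewrite sqrtr_gt0 divr_gt0 // subr_gt0 lt_neqAle le_enorm andbT.
apply: contraNneq vL => e; apply/andP; split; last by rewrite e enorm_ge0.
have := sqr_enorm v; rewrite -e => /eqP.
by rewrite -subr_eq0 opprD addrA subrr sub0r oppr_eq0 sqrf_eq0.
Qed.

Lemma sqr_height v : height v ^+ 2 = (enorm v - v.1) / 2.
Proof. by rewrite sqr_sqrtr // divr_ge0 // subr_ge0 le_enorm. Qed.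

Lemma slit_coordK v : ~~ on_slit v -> slit_point (slit_coord v) = v.
Proof.
move=> /height_gt0 y0; rewrite /slit_point /slit_coord /csquare /= opprK lnK ?posrE //.
have yN0 : height v != 0 by rewrite gt_eqF.
case: v y0 yN0 (sqr_height v) (sqr_enorm v) => a b /= y0 yN0 hy hn.
congr (_, _); last by field.
have e : enorm (a, b) = 2 * height (a, b) ^+ 2 + a by rewrite hy; field.
move: hn; rewrite e; set y := height _ in y0 yN0 hy e * => hn.
have hb : b ^+ 2 = 4 * y ^+ 2 * (y ^+ 2 + a).
  have -> : b ^+ 2 = (a ^+ 2 + b ^+ 2) - a ^+ 2 by ring.
  by rewrite -hn; ring.
by rewrite exprMn exprVn exprMn hb; field.
Qed.

Lemma height_csquare P : 0 <= P.2 -> height (csquare P) = P.2.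
Proof.
move=> y0.
have e : enorm (csquare P) = P.1 ^+ 2 + P.2 ^+ 2.
  rewrite /enorm /csquare /=.
  have -> : (P.1 ^+ 2 - P.2 ^+ 2) ^+ 2 + (2 * P.1 * P.2) ^+ 2 =
    (P.1 ^+ 2 + P.2 ^+ 2) ^+ 2 by ring.
  by rewrite sqrtr_sqr ger0_norm // addr_ge0 // sqr_ge0.
rewrite /height e /csquare /=.
have -> : (P.1 ^+ 2 + P.2 ^+ 2 - (P.1 ^+ 2 - P.2 ^+ 2)) / 2 = P.2 ^+ 2 by field.
by rewrite sqrtr_sqr ger0_norm.
Qed.

Lemma slit_pointK P : slit_coord (slit_point P) = P.
Proof.
rewrite /slit_coord /slit_point height_csquare /= ?expR_ge0 // expRK opprK.
by case: P => m w /=; congr (_, _); field; rewrite gt_eqF // expR_gt0.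
Qed.

Lemma csquare_off_slit P : 0 < P.2 -> ~~ on_slit (csquare P).
Proof.
move=> y0; rewrite /on_slit /csquare /= !mulf_eq0 pnatr_eq0 (gt_eqF y0) orbF /=.
by apply/negP => /andP[/eqP ->]; rewrite expr0n sub0r oppr_ge0 leNgt exprn_gt0.
Qed.

Lemma slit_point_off_slit P : ~~ on_slit (slit_point P).
Proof. by apply: csquare_off_slit => /=; exact: expR_gt0. Qed.

Lemma continuous_csquare P : {for P, continuous csquare}.
Proof.
rewrite /csquare; apply: continuous_pair; rewrite /continuous_at.
  by apply: cvgB; apply: cvgM; (exact: cvg_fst || exact: cvg_snd).
apply: cvgM; last exact: cvg_snd.
by apply: cvgM; [exact: cvg_cst|exact: cvg_fst].
Qed.

Lemma continuous_slit_point P : {for P, continuous slit_point}.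
Proof.
apply: (continuous_comp (f := fun P => (P.1, expR (- P.2))) (g := csquare));
  last exact: continuous_csquare.
apply: continuous_pair; first exact: cvg_fst.
apply: (continuous_comp (f := fun P => - P.2)); last exact: continuous_expR.
by rewrite /continuous_at; apply: cvgN; exact: cvg_snd.
Qed.

Lemma continuous_enorm v : {for v, continuous (@enorm R)}.
Proof.
have -> : @enorm R = (fun q => enorm (q.1, q.2)).
  by apply/funext => -[].
by apply: continuous_enorm_pair; [exact: cvg_fst|exact: cvg_snd].
Qed.

Lemma continuous_height v : {for v, continuous height}.
Proof.
apply: (continuous_comp (f := fun v => (enorm v - v.1) / 2) (g := Num.sqrt));
  last exact: sqrt_continuous.
rewrite /continuous_at; apply: cvgM; last exact: cvg_cst.
by apply: cvgB; [exact: continuous_enorm|exact: cvg_fst].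
Qed.

Lemma continuous_slit_coord v : ~~ on_slit v -> {for v, continuous slit_coord}.
Proof.
move=> /height_gt0 y0; rewrite /slit_coord; apply: continuous_pair; rewrite /continuous_at.
  apply: cvgM; first exact: cvg_snd.
  apply: cvgV; first by rewrite mulf_neq0 // gt_eqF.
  by apply: cvgM; [exact: cvg_cst|exact: continuous_height].
apply: cvgN; apply: (continuous_comp (f := height)).
  exact: continuous_height.
exact: continuous_ln.
Qed.

Lemma open_off_slit : open [set v | ~~ on_slit v].
Proof.
have -> : [set v | ~~ on_slit v] = [set v | v.2 != 0] `|` [set v | v.1 < 0].
  apply/seteqP; split => v /=; rewrite /on_slit negb_and -ltNge.
    by case/orP; [left|right].
  by case=> -> //; rewrite orbT.
apply: openU.
  have -> : [set v : R * R | v.2 != 0] = snd @^-1` (~` [set 0]).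
    by apply/seteqP; split => v /= /eqP.
  apply: open_comp; first by move=> v _; exact: cvg_snd.
  by apply: closed_openC; exact: closed_eq.
have -> : [set v : R * R | v.1 < 0] = fst @^-1` [set y | y < 0] by [].
by apply: open_comp; [move=> v _; exact: cvg_fst|exact: open_lt].
Qed.

End Fold.

(** * The twisted Moore surface *)

(** A point of the seam of x is recorded by its abscissa in the plane of
    [chart x]. *)
Inductive moore (R : realType) :=
  | Inner of (R * R)
  | Seam of (nat -> bool) & {a : R | 0 <= a}.
Arguments Inner {R}.
Arguments Seam {R}.

HB.instance Definition _ (R : realType) := gen_eqMixin (moore R).
HB.instance Definition _ (R : realType) := gen_choiceMixin (moore R).
HB.instance Definition _ (R : realType) := isPointed.Build (moore R) (Inner 0).

Section Charts.
Variable R : realType.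
Implicit Types (P v z : R * R) (x : nat -> bool) (p : moore R).

Definition nneg0 : {a : R | 0 <= a} := exist _ 0 (lexx 0).

(** The default value of [insubd] is never taken, since [on_slit] gives the
    sign. *)
Definition chart x v : moore R :=
  if on_slit v then Seam x (insubd nneg0 v.1) else Inner (weld x (slit_coord v)).

Definition unchart x p : R * R :=
  match p with Inner z => slit_point (unweld x z) | Seam _ a => (val a, 0) end.

Definition in_chart x p : Prop :=
  match p with Inner _ => True | Seam x' _ => x' = x end.

Lemma chartK x : cancel (chart x) (unchart x).
Proof.
move=> v; rewrite /chart; case: ifPn => [|vL] /=; last by rewrite weldK slit_coordK.
case: v => a b /andP[/= /eqP -> a0].
by rewrite val_insubd a0.
Qed.

Lemma unchartK x p : in_chart x p -> chart x (unchart x p) = p.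
Proof.
case: p => [z _|x' a /= ->] /=; rewrite /chart.
  by rewrite (negbTE (slit_point_off_slit _)) slit_pointK unweldK.
rewrite /on_slit /= eqxx (valP a); congr Seam.
by apply: val_inj; rewrite val_insubd (valP a).
Qed.

Lemma chart_in x v : in_chart x (chart x v).
Proof. by rewrite /chart; case: ifP. Qed.

(** The final topology for the charts. *)
Definition moore_open (A : set (moore R)) := forall x, open (chart x @^-1` A).

Lemma moore_openT : moore_open setT.
Proof. by move=> x; rewrite preimage_setT; exact: openT. Qed.

Lemma moore_openI : setI_closed moore_open.
Proof. by move=> A B oA oB x; rewrite preimage_setI; exact: openI. Qed.

Lemma moore_open_bigU (I : Type) (f : I -> set (moore R)) :
  (forall i, moore_open (f i)) -> moore_open (\bigcup_i f i).
Proof.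
by move=> of_ x; rewrite preimage_bigcup; apply: bigcup_open => i _; exact: of_.
Qed.

HB.instance Definition _ := isOpenTopological.Build (moore R)
  moore_openT moore_openI moore_open_bigU.

Lemma moore_openE (A : set (moore R)) :
  open A = (forall x, open (chart x @^-1` A)).
Proof. by []. Qed.

Lemma continuous_chart x : continuous (chart x).
Proof. by apply/continuousP => A; rewrite moore_openE; apply. Qed.

Lemma chart_Inner x v z : chart x v = Inner z ->
  ~~ on_slit v /\ weld x (slit_coord v) = z.
Proof. by rewrite /chart; case: ifPn => // vL []. Qed.

Lemma chart_slit_point x z : chart x (slit_point (unweld x z)) = Inner z.
Proof. by rewrite /chart (negbTE (slit_point_off_slit _)) slit_pointK unweldK. Qed.

Lemma continuous_weld_slit_coord x v : ~~ on_slit v ->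
  {for v, continuous (weld x \o @slit_coord R)}.
Proof.
by move=> vL; apply: continuous_comp;
  [exact: continuous_slit_coord|exact: continuous_weld].
Qed.

Lemma continuous_transition x x' v : ~~ on_slit v ->
  {for v, continuous (@slit_point R \o (unweld x \o (weld x' \o @slit_coord R)))}.
Proof.
move=> vL; apply: continuous_comp; last exact: continuous_slit_point.
apply: continuous_comp; last exact: continuous_unweld.
exact: continuous_weld_slit_coord.
Qed.

(** Two charts of different sequences meet in the complements of the slits,
    where the transition is continuous. *)
Lemma open_chart x (U : set (R * R)) : open U -> open (chart x @` U).
Proof.
move=> oU; rewrite moore_openE => x'.
have [->|x'x] := pselect (x' = x).
  suff -> : chart x @^-1` (chart x @` U) = U by [].
  apply/seteqP; split => v /=; last by exists v.
  by move=> [u Uu /(can_inj (chartK x)) <-].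
pose h v := slit_point (unweld x (weld x' (slit_coord v))).
have -> : chart x' @^-1` (chart x @` U) = [set v | ~~ on_slit v] `&` h @^-1` U.
  apply/seteqP; split => v /=.
    move=> [u Uu]; rewrite {2}/chart; case: ifPn => vL.
      by move=> e; have := chart_in x u; rewrite e.
    by move=> /chart_Inner[uL e]; split => //; rewrite /h /= -e weldK slit_coordK.
  move=> [vL Uh]; exists (h v) => //.
  by rewrite /h chart_slit_point /chart (negbTE vL).
rewrite openE => v /= [vL Uv].
apply: filterI; first by apply: open_nbhs_nbhs; split => //; exact: open_off_slit.
by apply: (@continuous_transition x x' v vL); apply: open_nbhs_nbhs.
Qed.

Lemma range_chart x : range (chart x) = [set p | in_chart x p].
Proof.
apply/seteqP; split => p /=; first by move=> [v _ <-]; exact: chart_in.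
by move=> xp; exists (unchart x p) => //; rewrite unchartK.
Qed.

Lemma open_in_chart x : open [set p | in_chart x p].
Proof. by rewrite -range_chart; apply: open_chart; exact: openT. Qed.

Lemma continuous_unchart x p : in_chart x p -> {for p, continuous (unchart x)}.
Proof.
move=> xp N /=; rewrite nbhsE /= => -[U [oU Up] UN].
apply: (@filterS _ _ _ (chart x @` U)); last first.
  apply: open_nbhs_nbhs; split; first exact: open_chart.
  by exists (unchart x p) => //; rewrite unchartK.
by move=> _ [u Uu <-]; apply: UN; rewrite chartK.
Qed.

Lemma continuous_Inner : continuous (@Inner R).
Proof.
pose x : nat -> bool := fun=> false.
have -> : @Inner R = chart x \o (@slit_point R \o unweld x).
  by apply/funext => z /=; rewrite chart_slit_point.
move=> z; apply: continuous_comp; last exact: continuous_chart.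
by apply: continuous_comp; [exact: continuous_unweld|exact: continuous_slit_point].
Qed.

Definition inner p : R * R := if p is Inner z then z else 0.

Lemma open_Inner (U : set (R * R)) : open U -> open (@Inner R @` U).
Proof.
move=> oU; rewrite moore_openE => x.
have -> : chart x @^-1` (Inner @` U) =
    [set v | ~~ on_slit v] `&` (weld x \o @slit_coord R) @^-1` U.
  apply/seteqP; split => v /=.
    by move=> [z Uz /esym /chart_Inner [vL ->]].
  by move=> [vL Uv]; exists (weld x (slit_coord v)) => //; rewrite /chart (negbTE vL).
rewrite openE => v /= [vL Uv].
apply: filterI; first by apply: open_nbhs_nbhs; split => //; exact: open_off_slit.
by apply: (@continuous_weld_slit_coord x v vL); apply: open_nbhs_nbhs.
Qed.

Lemma continuous_inner z : {for Inner z, continuous inner}.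
Proof.
move=> N /=; rewrite nbhsE /= => -[U [oU Up] UN].
apply: (@filterS _ _ _ (@Inner R @` U)).
  by move=> _ [u Uu <-]; exact: UN.
by apply: open_nbhs_nbhs; split; [exact: open_Inner|exists z].
Qed.

End Charts.

(** * Topology of the surface *)
Section Surface.
Variable R : realType.
Implicit Types (P v z : R * R) (x : nat -> bool) (p : moore R).

Lemma first_difference x x' : x <> x' ->
  exists k, (forall j, (j < k)%N -> x j = x' j) /\ x k != x' k.
Proof.
move=> xx'; have : exists k, x k != x' k.
  apply: contrapT => /forallNP h; apply: xx'; apply/funext => k.
  by have [//|xk] := eqVneq (x k) (x' k); case: (h k).
move=> /ex_minnP[k hk kmin]; exists k; split => // j jk.
by apply/eqP; apply: contraLR jk => /kmin; rewrite leqNgt.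
Qed.

(** Twists move m by at most 2 and do not change the strip, so a common value
    would bound the difference of the drifts. *)
Lemma weld_apart x x' (C : R) : x <> x' ->
  exists W : R, forall P P', W <= P.2 -> `|P.1| <= C -> `|P'.1| <= C ->
    weld x P <> weld x' P'.
Proof.
move=> /first_difference[k [xx' xk]].
pose q : R := 4^-1 ^+ k / 2; have q0 : 0 < q.
  by rewrite divr_gt0 // exprn_gt0 // invr_gt0.
pose D := (2 * C + 5) / q.
exists (k.+2%:R + Num.max 0 D) => P P' PW PC P'C.
rewrite /weld; set Q := twists _ x P; set Q' := twists _ x' P' => e.
have e2 : Q.2 = Q'.2 := congr1 snd e.
have e1 : Q.1 + drift x Q.2 = Q'.1 + drift x' Q'.2 := congr1 fst e.
rewrite -e2 in e1.
have Pk : 1 <= P.2.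
  apply: le_trans PW; rewrite -[k.+2]addn1 natrD.
  by rewrite -addrA addrCA lerDl addr_ge0 // le_max lexx.
have tQ : Num.truncn Q.2 = Num.truncn P.2 by exact: truncn_twists.
have Q1 : 1 <= Q.2 by rewrite -truncn_gt0 tQ truncn_gt0.
have Q2 : P.2 - 1 <= Q.2.
  have : (Num.truncn Q.2)%:R <= Q.2 by rewrite truncn_le (le_trans _ Q1).
  apply: le_trans; rewrite tQ lerBlDr natr1.
  exact/ltW/truncnS_gt.
have Qk : k.+1%:R + Num.max 0 D <= Q.2.
  apply: le_trans Q2; rewrite lerBrDr; apply: le_trans PW.
  by rewrite -[k.+2]addn1 natrD addrAC.
have Qk1 : k.+1%:R <= Q.2 by apply: le_trans Qk; rewrite lerDl le_max lexx.
have := drift_apart xx' xk Qk1; rewrite -/q => hd.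
have hq : 2 * C + 5 <= q * (Q.2 - k.+1%:R).
  rewrite -ler_pdivrMl // mulrC -/D; move: Qk.
  have : D <= Num.max 0 D by rewrite le_max lexx orbT.
  by move=> h1 h2; lra.
have hs : `|drift x Q.2 - drift x' Q.2| <= 2 * C + 4.
  have -> : drift x Q.2 - drift x' Q.2 = Q'.1 - Q.1 by lra.
  have := twists_near 1 x P; have := twists_near 1 x' P'.
  rewrite -/Q -/Q'; move: PC P'C; rewrite !ler_norml.
  move=> /andP[? ?] /andP[? ?] /andP[? ?] /andP[? ?].
  by apply/andP; split; lra.
by have := le_trans (le_trans hq hd) hs; lra.
Qed.

(** Neighbourhoods of a piece of the seam, where m is bounded and w is large. *)
Definition tail_nbhd (C W : R) : set (R * R) :=
  [set v | v.1 < C /\ height v < expR (- W)].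

Lemma open_tail_nbhd C W : open (tail_nbhd C W).
Proof.
have -> : tail_nbhd C W = fst @^-1` [set y | y < C] `&`
    (@height R) @^-1` [set y | y < expR (- W)] by [].
apply: openI; apply: open_comp; try exact: open_lt.
  by move=> v _; exact: cvg_fst.
by move=> v _; exact: continuous_height.
Qed.

Lemma slit_coord_tail C W v : 0 <= W -> 0 <= C ->
  tail_nbhd C W v -> ~~ on_slit v ->
  W <= (slit_coord v).2 /\ `|(slit_coord v).1| <= C + 1.
Proof.
move=> W0 C0 [vC vW] vL; have y0 := height_gt0 vL.
have Wr : W <= (slit_coord v).2.
  rewrite /slit_coord /= lerNr -[leRHS]expRK ler_ln ?posrE ?expR_gt0 //.
  exact: ltW.
split=> //; have := slit_coordK vL; case: v vC {vW vL y0} Wr => a b /= aC.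
set r := slit_coord _ => Wr [/= ea _].
have e1 : expR (- r.2) ^+ 2 <= 1.
  rewrite expr_le1 ?expR_ge0 // -expR0 ler_expR oppr_le0.
  exact: le_trans Wr.
have : r.1 ^+ 2 <= (C + 1) ^+ 2.
  have -> : r.1 ^+ 2 = a + expR (- r.2) ^+ 2 by rewrite -ea subrK.
  by apply: (@le_trans _ _ (C + 1)); [lra|nra].
rewrite -[r.1 ^+ 2]real_normK ?num_real // ler_pXn2r // nnegrE.
by rewrite addr_ge0.
Qed.

(** Two points of one chart are separated there; the only other case is that of
    points of two different seams. *)
Lemma hausdorff_moore : hausdorff_space (moore R).
Proof.
have same x p q : in_chart x p -> in_chart x q -> p != q ->
    exists2 AB : set (moore R) * set (moore R), (p \in AB.1 /\ q \in AB.2) &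
      [/\ open AB.1, open AB.2 & AB.1 `&` AB.2 == set0].
  move=> xp xq pq.
  have uv : unchart x p != unchart x q.
    by apply: contra pq => /eqP e; rewrite -(unchartK xp) e (unchartK xq).
  have := @norm_hausdorff R (R * R)%type.
  rewrite open_hausdorff => /(_ _ _ uv)[[A B] /= [Ap Bq] [oA oB AB]].
  exists (chart x @` A, chart x @` B) => /=.
    split; rewrite inE; [exists (unchart x p)|exists (unchart x q)];
      rewrite ?unchartK //; exact: set_mem.
  split; try exact: open_chart.
  apply/eqP; rewrite -subset0 => r [[a Aa <-] [b Bb]].
  move=> /(can_inj (chartK x)) ba; move: AB => /eqP/seteqP[/(_ a) h _].
  by apply: h; split => //; rewrite -ba.
rewrite open_hausdorff => p q pq.
case: p q pq => [z|x a] [z'|x' a'] pq.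
- by apply: (same (fun=> false)).
- by apply: (same x').
- by apply: (same x).
have [xx'|xx'] := pselect (x = x').
  by rewrite -xx' in pq *; apply: (same x).
pose C := 1 + Num.max (val a) (val a').
have C0 : 0 <= C by rewrite addr_ge0 // le_max (valP a).
have [W' hW] := @weld_apart x x' (C + 1) xx'.
pose W := Num.max 0 W'.
have W0 : 0 <= W by rewrite le_max lexx.
have tn (b : R) : 0 <= b -> b < C -> tail_nbhd C W (b, 0).
  move=> b0 bC; split => //; rewrite /height /enorm /=.
  by rewrite expr0n addr0 sqrtr_sqr ger0_norm // subrr mul0r sqrtr0 expR_gt0.
exists (chart x @` tail_nbhd C W, chart x' @` tail_nbhd C W) => /=.
  have h y (b : {a : R | 0 <= a}) : val b < C ->
      Seam y b \in chart y @` tail_nbhd C W.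
    move=> bC; rewrite inE; exists (val b, 0); first exact: tn (valP b) bC.
    by rewrite -[LHS]/(chart y (unchart y (Seam y b))) unchartK.
  split; apply: h; rewrite /C -ltrBlDl.
    by rewrite lt_max; apply/orP; left; lra.
  by rewrite lt_max; apply/orP; right; lra.
split; try by apply: open_chart; exact: open_tail_nbhd.
apply/eqP; rewrite -subset0 => r [[u Tu ur] [u' Tu']].
rewrite -ur /chart; case: ifPn => u'L; case: ifPn => uL //.
  by case=> e; case: xx'.
move=> /esym /(congr1 (@inner R)); have [h1 h2] := slit_coord_tail W0 C0 Tu uL.
have [h3 h4] := slit_coord_tail W0 C0 Tu' u'L.
by apply: hW => //; apply: le_trans h1; rewrite /W le_max lexx orbT.
Qed.

Definition to_row v : 'rV[R]_2 := \row_i (if i == ord0 then v.1 else v.2).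
Definition of_row (r : 'rV[R]_2) : R * R := (r ord0 ord0, r ord0 (lift ord0 ord0)).

Lemma to_rowK : cancel to_row of_row.
Proof. by case=> a b; rewrite /of_row !mxE. Qed.

Lemma of_rowK : cancel of_row to_row.
Proof.
move=> r; apply/matrixP => i j; rewrite !mxE ord1.
case: (unliftP ord0 j) => [k ->|->] //=.
by rewrite (ord1 k).
Qed.

Lemma continuous_of_row : continuous of_row.
Proof. by move=> r; apply: continuous_pair; exact: coord_continuous. Qed.

Lemma continuous_to_row : continuous to_row.
Proof.
move=> v; apply/cvg_ballP => e e0.
have /cvg_ballP/(_ e e0) h1 : fst @ v --> v.1 by exact: cvg_fst.
have /cvg_ballP/(_ e e0) h2 : snd @ v --> v.2 by exact: cvg_snd.
near=> w; split=> // i j; rewrite !mxE; case: ifP => _; near: w.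
  exact: h1.
exact: h2.
Unshelve. all: by end_near. Qed.

Lemma locally_euclidean_moore : locally_euclidean R 2 (moore R).
Proof.
move=> p; have [x xp] : exists x, in_chart x p.
  by case: p => [z|x a]; [exists (fun=> false)|exists x].
exists [set p | in_chart x p], setT, (to_row \o unchart x); split => //.
- exact: open_in_chart.
- exact: openT.
split.
- split=> //.
    move=> a b; rewrite !inE /= => xa xb /(can_inj to_rowK) e.
    by rewrite -(unchartK xa) e (unchartK xb).
  move=> r _; exists (chart x (of_row r)); first exact: chart_in.
  by rewrite /= chartK of_rowK.
- apply: continuous_in_subspaceT => a; rewrite inE => xa.
  by apply: continuous_comp; [exact: continuous_unchart|exact: continuous_to_row].
- exists (chart x \o of_row).
    apply: continuous_subspaceT => r.
    by apply: continuous_comp; [exact: continuous_of_row|exact: continuous_chart].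
  by move=> a; rewrite inE /= => xa; rewrite to_rowK unchartK.
Qed.

Lemma separable_moore : separable (moore R).
Proof.
pose D : set (moore R) := range (fun q : rat * rat => Inner (ratr q.1, ratr q.2)).
exists D; first by apply: (sub_countable (card_image_le _ _)).
move=> A [p Ap] oA.
suff [z Az] : exists z, A (Inner z).
  have : open (@Inner R @^-1` A).
    by apply: open_comp => // z' _; exact: continuous_Inner.
  rewrite openE => /(_ _ Az); rewrite /interior /= => -[[U V] /= [Uz Vz] UV].
  have := @dense_rat R U°; have := @dense_rat R V°.
  have nU : U° !=set0 by exists z.1; exact: nbhs_singleton (nbhs_interior Uz).
  have nV : V° !=set0 by exists z.2; exact: nbhs_singleton (nbhs_interior Vz).
  move=> /(_ nV (open_interior _))[b' [/= /interior_subset Vb [b _ eb]]].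
  move=> /(_ nU (open_interior _))[a' [/= /interior_subset Ua [a _ ea]]].
  exists (Inner (ratr a, ratr b)); split; last by exists (a, b).
  by apply: (UV (_, _)); split => /=; rewrite ?ea ?eb.
case: p Ap => [z Az|x a Aa]; first by exists z.
have : open (chart x @^-1` A) by apply: oA.
rewrite openE => /(_ (val a, 0)).
have e : chart x (val a, 0) = Seam x a.
  by rewrite -[LHS]/(chart x (unchart x (Seam x a))) unchartK.
rewrite /= e => /(_ Aa) /nbhs_ballP[r /= r0 hr].
have nL : ~~ on_slit (val a, r / 2).
  by rewrite /on_slit /= negb_and gt_eqF // divr_gt0.
exists (weld x (slit_coord (val a, r / 2))).
have := hr (val a, r / 2); rewrite /= /chart (negbTE nL); apply.
split => /=; first exact: ballxx.
rewrite /ball /= sub0r normrN ger0_norm ?divr_ge0 ?ltW //.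
by rewrite ltr_pdivrMr // ltr_pMr // ltr1n.
Qed.

End Surface.

(** * Induction on intervals, clamping and pasting *)
Section RealLine.
Variable R : realType.

(** The set of the t with Pr A t has a supremum, which can be passed as long as
    it is not B. *)
Lemma interval_induction (A B : R) (Pr : R -> R -> Prop) : A <= B ->
  (forall a b c, a <= b -> b <= c -> Pr a b -> Pr b c -> Pr a c) ->
  (forall t, A <= t <= B -> exists2 e, 0 < e & forall a b,
     A <= a -> a <= b -> b <= B -> t - e < a -> b < t + e -> Pr a b) ->
  Pr A B.
Proof.
move=> AB Ptrans Ploc.
pose S := [set t | A <= t <= B /\ Pr A t].
have SA : S A.
  split; first by rewrite lexx.
  have [|e e0 h] := Ploc A; first by rewrite lexx.
  by apply: h => //; [rewrite ltrBlDr ltrDl|rewrite ltrDl].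
have hS : has_sup S by split; [exists A|exists B => t [/andP[]]].
have Am : A <= sup S by apply: ub_le_sup => //; case: hS.
have mB : sup S <= B by apply: ge_sup; [exists A|move=> t [/andP[]]].
have [|e e0 h] := Ploc (sup S); first by rewrite Am.
have [s [/andP[As sB] PAs] hs] := sup_adherent e0 hS.
have sm : s <= sup S by apply: ub_le_sup; [case: hS|split; rewrite ?As].
pose t := Num.min B (sup S + e / 2).
have st : s <= t.
  by rewrite le_min sB (le_trans sm) // lerDl divr_ge0 // ltW.
have PAt : Pr A t.
  apply: (Ptrans _ s) => //; apply: h => //; first by rewrite ge_min lexx.
  rewrite gt_min; apply/orP; right; lra.
have : t <= sup S.
  apply: ub_le_sup; first by case: hS.
  by split => //; rewrite (le_trans As) //= ge_min lexx.
rewrite ge_min => /orP[Bs|]; last by move=> ?; lra.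
suff <- : t = B by [].
by apply/min_idPl; apply: (le_trans Bs); rewrite lerDl divr_ge0 // ltW.
Qed.

Definition clamp (a b t : R) := Num.max a (Num.min t b).

Lemma clampP a b t : a <= b -> a <= clamp a b t <= b.
Proof. by move=> ab; rewrite /clamp le_max lexx ge_max ab ge_min lexx orbT. Qed.

Lemma clamp_id a b t : a <= t <= b -> clamp a b t = t.
Proof. by case/andP => at_ tb; rewrite /clamp min_l // max_r. Qed.

Lemma continuous_clamp a b : continuous (clamp a b).
Proof.
move=> t; apply: (continuous_max (f := fun=> a) (g := fun t => Num.min t b)).
  exact: cvg_cst.
apply: (continuous_min (f := fun t => t) (g := fun=> b)); first exact: cvg_id.
exact: cvg_cst.
Qed.

Lemma continuous_comp_clamp (T : topologicalType) a b (c : R -> T) : a <= b ->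
  {within `[a, b], continuous c} -> continuous (c \o clamp a b).
Proof.
move=> ab /subspace_continuousP cc t.
have tab : `[a, b]%classic (clamp a b t) by rewrite /= in_itv /= clampP.
move=> N /(cc _ tab) hN.
have h : \forall u \near t,
    `[a, b]%classic (clamp a b u) -> N (c (clamp a b u)).
  exact: (@continuous_clamp a b t _ hN).
rewrite /= nbhs_simpl /=; apply: filterS h => u; apply.
by rewrite /= in_itv /= clampP.
Qed.

Lemma continuous_paste (T U : topologicalType) (phi : T -> R) (r : R)
    (u v : T -> U) : continuous phi -> continuous u -> continuous v ->
  (forall q, phi q = r -> u q = v q) ->
  continuous (fun q => if phi q <= r then u q else v q).
Proof.
move=> cphi cu cv uv q.
have [qr|rq|qr] := ltgtP (phi q) r.
- apply: near_continuous (cu q); near=> q' => /=.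
  by rewrite ltW //; near: q'; exact: (cvgr_lt _ (cphi q) _ qr).
- apply: near_continuous (cv q); near=> q' => /=.
  by rewrite lt_geF //; near: q'; exact: (cvgr_gt _ (cphi q) _ rq).
- rewrite /continuous_at qr lexx => N hN; have hu : nbhs q (u @^-1` N) := cu q _ hN.
  have := hN; rewrite (uv _ qr) => /(cv q) hv; have {}hv : nbhs q (v @^-1` N) := hv.
  by rewrite /= nbhs_simpl /=; apply: filterS2 hu hv => q' Nu Nv /=; case: ifP.
Unshelve. all: by end_near. Qed.

End RealLine.

(** * Simple connectivity *)
Section Loops.
Variable R : realType.
Implicit Types (P v z : R * R) (x : nat -> bool) (p : moore R).

Definition base : moore R := Inner 0.

(** The path is affine in the half plane, or in the chart of the seam to which p
    belongs. It depends on p only, yet stays in every chart that contains p. *)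
Definition spoke p (s : R) : moore R :=
  match p with
  | Inner z => Inner ((1 - s) *: z)
  | Seam x a => chart x ((1 - s) *: (val a, 0) + s *: unchart x base)
  end.

Lemma spoke0 p : spoke p 0 = p.
Proof.
case: p => [z|x a] /=; first by rewrite subr0 scale1r.
rewrite subr0 scale1r scale0r addr0.
by rewrite -[LHS]/(chart x (unchart x (Seam x a))) unchartK.
Qed.

Lemma spoke1 p : spoke p 1 = base.
Proof.
case: p => [z|x a] /=; first by rewrite subrr scale0r.
by rewrite subrr scale1r scale0r add0r -[slit_point _]/(unchart x base) unchartK.
Qed.

Lemma spoke_in x p s : in_chart x p -> in_chart x (spoke p s).
Proof. by case: p => [z|x' a /= ->] //=; exact: chart_in. Qed.

Lemma continuous_spoke p : continuous (spoke p).
Proof.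
have c1 : continuous (fun s : R => 1 - s).
  by move=> s; rewrite /continuous_at; apply: cvgB; [exact: cvg_cst|exact: cvg_id].
case: p => [z|x a] s.
  apply: (continuous_comp (f := fun s : R => (1 - s) *: z) (g := @Inner R));
    last exact: continuous_Inner.
  by rewrite /continuous_at; apply: cvgZr_tmp; exact: c1.
apply: (continuous_comp
  (f := fun s : R => (1 - s) *: (val a, 0) + s *: unchart x base)
  (g := chart x)); last exact: continuous_chart.
rewrite /continuous_at; apply: cvgD; apply: cvgZr_tmp; first exact: c1.
exact: cvg_id.
Qed.

Lemma path_connected_moore : path_connected R (moore R).
Proof.
move=> p q.
pose c (t : R) := if t <= 1 / 2 then spoke p (2 * t) else spoke q (2 - 2 * t).
exists c; split.
- apply: continuous_subspaceT.
  apply: (@continuous_paste _ _ _ (fun t => t) (1 / 2)).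
  + by move=> t; exact: cvg_id.
  + move=> t; apply: (continuous_comp (f := fun t : R => 2 * t));
      last exact: continuous_spoke.
    by rewrite /continuous_at; apply: cvgM; [exact: cvg_cst|exact: cvg_id].
  + move=> t; apply: (continuous_comp (f := fun t : R => 2 - 2 * t));
      last exact: continuous_spoke.
    rewrite /continuous_at; apply: cvgB; first exact: cvg_cst.
    by apply: cvgM; [exact: cvg_cst|exact: cvg_id].
  + move=> t ->; have -> : 2 * (1 / 2) = 1 :> R by field.
    have -> : 2 - 1 = 1 :> R by ring.
    by rewrite !spoke1.
- by rewrite /c divr_ge0 // mulr0 spoke0.
- rewrite /c ifF; last by apply/negbTE; rewrite -ltNge; lra.
  by rewrite mulr1 subrr spoke0.
Qed.

Lemma connected_moore : connected [set: moore R].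
Proof.
have -> : [set: moore R] = \bigcup_(p in setT) (spoke p @` `[0, 1]).
  apply/seteqP; split => p _ //; exists p => //; exists 0; last exact: spoke0.
  by rewrite /= in_itv /= lexx ler01.
apply: bigcup_connected.
  exists base => p _; exists 1; last exact: spoke1.
  by rewrite /= in_itv /= lexx ler01.
move=> p _; apply: connected_continuous_connected.
  exact: segment_connected.
by apply: continuous_subspaceT; exact: continuous_spoke.
Qed.

(** A free contraction of c on [a, b] to the base point, under which both ends
    move along their spokes. *)
Definition fill (c : R -> moore R) (a b : R) := exists h : R * R -> moore R,
  [/\ continuous h,
      forall t, a <= t <= b -> h (0, t) = c t,
      forall t, a <= t <= b -> h (1, t) = base
    & forall s, h (s, a) = spoke (c a) s /\ h (s, b) = spoke (c b) s].

Lemma fill_trans c a b d : a <= b -> b <= d ->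
  fill c a b -> fill c b d -> fill c a d.
Proof.
move=> ab bd [h [ch h0 h1 hs]] [k [ck k0 k1 ks]].
exists (fun q => if q.2 <= b then h q else k q); split.
- apply: continuous_paste => // [q|[s t] /= ->]; first exact: cvg_snd.
  by rewrite (hs s).2 (ks s).1.
- move=> t /andP[at_ td] /=; case: ifPn => [tb|]; first by rewrite h0 // at_.
  by rewrite -ltNge => /ltW bt; rewrite k0 // bt.
- move=> t /andP[at_ td] /=; case: ifPn => [tb|]; first by rewrite h1 // at_.
  by rewrite -ltNge => /ltW bt; rewrite k1 // bt.
- move=> s /=; rewrite ab; split; first by rewrite (hs s).1.
  have [db|_] := leP d b; last by rewrite (ks s).2.
  have -> : d = b by apply/eqP; rewrite eq_le db.
  by rewrite (hs s).2.
Qed.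

(** In the plane of the chart, the Coons patch interpolates the four prescribed
    sides of the rectangle. *)
Lemma fill_chart x c a b : continuous c -> a <= b ->
  (forall t, a <= t <= b -> in_chart x (c t)) -> fill c a b.
Proof.
move=> cc; rewrite le_eqVlt => /predU1P[<-|ab] xc.
  exists (fun q => spoke (c a) q.1); split=> //.
  - move=> q; apply: (continuous_comp (f := fst)); last exact: continuous_spoke.
    exact: cvg_fst.
  - by move=> t; rewrite -eq_le => /eqP <-; rewrite spoke0.
  - by move=> t _; rewrite spoke1.
have ab' : a <= b := ltW ab.
have xa : in_chart x (c a) by apply: xc; rewrite lexx.
have xb : in_chart x (c b) by apply: xc; rewrite ab' lexx.
pose C t := unchart x (c (clamp a b t)).
pose tau t := (t - a) / (b - a).
pose gam s := unchart x (spoke (c a) s); pose gb s := unchart x (spoke (c b) s).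
(* The first line is affine in s; the second line vanishes at both ends of the
   spokes and corrects the vertical sides. *)
pose H (q : R * R) : R * R :=
  ((1 - q.1) *: C q.2 + q.1 *: ((1 - tau q.2) *: C a + tau q.2 *: C b)) +
  ((1 - tau q.2) *: (gam q.1 - C a) + tau q.2 *: (gb q.1 - C b)).
have Ca : C a = unchart x (c a) by rewrite /C clamp_id // lexx.
have Cb : C b = unchart x (c b) by rewrite /C clamp_id // lexx ab'.
have ba0 : b - a != 0 by rewrite subr_eq0 gt_eqF.
have tau_a : tau a = 0 by rewrite /tau subrr mul0r.
have tau_b : tau b = 1 by rewrite /tau divff.
exists (chart x \o H); split.
- have cC : continuous C.
    move=> t; apply: (continuous_comp (f := c \o clamp a b)); last first.
      by apply: continuous_unchart; apply: xc; apply: clampP.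
    by apply: continuous_comp; [exact: continuous_clamp|exact: cc].
  have cg p : in_chart x p -> continuous (fun s => unchart x (spoke p s)).
    move=> xp s; apply: (continuous_comp (f := spoke p)); first exact: continuous_spoke.
    by apply: continuous_unchart; exact: spoke_in.
  have ct : continuous tau.
    move=> t; rewrite /continuous_at; apply: cvgM; last exact: cvg_cst.
    by apply: cvgB; [exact: cvg_id|exact: cvg_cst].
  move=> q; apply: continuous_comp; last exact: continuous_chart.
  have cf (T : topologicalType) (f : R -> T) : continuous f ->
      f q'.1 @[q' --> q] --> f q.1.
    by move=> cf; apply: (continuous_comp (f := fst)); [exact: cvg_fst|exact: cf].
  have cs (T : topologicalType) (f : R -> T) : continuous f ->
      f q'.2 @[q' --> q] --> f q.2.
    by move=> cf'; apply: (continuous_comp (f := snd)); [exact: cvg_snd|exact: cf'].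
  have c1 : continuous (fun s : R => 1 - s).
    by move=> s; rewrite /continuous_at; apply: cvgB; [exact: cvg_cst|exact: cvg_id].
  have c1t : continuous (fun s : R => 1 - tau s).
    by move=> s; rewrite /continuous_at; apply: cvgB; [exact: cvg_cst|exact: ct].
  rewrite /continuous_at /H; apply: cvgD; apply: cvgD.
  + by apply: cvgZ; [exact: (cf _ _ c1)|exact: cs].
  + apply: cvgZ; first exact: cvg_fst.
    by apply: cvgD; apply: cvgZr_tmp; [exact: (cs _ _ c1t)|exact: (cs _ _ ct)].
  + apply: cvgZ; first exact: (cs _ _ c1t).
    by apply: cvgB; [exact: (cf _ _ (cg _ xa))|exact: cvg_cst].
  + apply: cvgZ; first exact: cs.
    by apply: cvgB; [exact: (cf _ _ (cg _ xb))|exact: cvg_cst].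
- move=> t tab; rewrite /H /= /gam /gb !spoke0 Ca Cb !subrr !scaler0 !addr0.
  by rewrite subr0 scale1r scale0r addr0 /C clamp_id // unchartK //; exact: xc.
- move=> t tab; rewrite /H /= /gam /gb !spoke1 subrr scale0r add0r scale1r.
  rewrite !scalerBr.
  set u := _ *: C a; set w := _ *: C b.
  set d1 := (1 - tau t) *: _; set d2 := tau t *: _.
  have -> : u + w + (d1 - u + (d2 - w)) = d1 + d2.
    by rewrite addrACA subrKC subrKC.
  by rewrite /d1 /d2 -scalerDl subrK scale1r unchartK.
- move=> s; rewrite /H /= tau_a tau_b subr0 subrr !scale0r !scale1r !addr0 !add0r.
  rewrite -!scalerDl !subrK !scale1r !subrKC /gam /gb !unchartK //;
    exact: spoke_in.
Qed.

Lemma fill_segment c a b : continuous c -> a <= b -> fill c a b.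
Proof.
move=> cc ab; apply: interval_induction => //.
  by move=> *; apply: fill_trans; eassumption.
move=> t tab; have [x xt] : exists x, in_chart x (c t).
  by case: (c t) => [z|x a']; [exists (fun=> false)|exists x].
have : \forall u \near t, in_chart x (c u).
  apply: cc; apply: open_nbhs_nbhs; split; first exact: open_in_chart.
  by [].
move=> /nbhs_ballP[e /= e0 he]; exists e => // a' b' aa' ab' bb' ta' tb'.
apply: (@fill_chart x) => // u /andP[a'u ub']; apply: he.
by rewrite /ball /= ltr_distlC; apply/andP; split; lra.
Qed.

(** The contraction of a loop moves its base point along a spoke and back. It is
    first pushed to the three other sides of the square, along which the path is
    the spoke run forth and back, which then retracts to the base point. *)
Lemma simply_connected_moore : simply_connected R (moore R).
Proof.
split; first exact: path_connected_moore.
move=> c0 cc0 c01.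
have le01 : 0 <= 1 :> R by [].
pose c := c0 \o clamp 0 1.
have cc : continuous c by exact: continuous_comp_clamp.
have cE t : 0 <= t <= 1 -> c t = c0 t by move=> h; rewrite /c /= clamp_id.
have c0E : c 0 = c0 0 by rewrite cE // lexx ler01.
have c1E : c 1 = c0 0 by rewrite cE ?lexx ?ler01.
have [h [ch h0 h1 hs]] := fill_segment cc le01.
rewrite c0E c1E in hs; set b := c0 0 in hs c0E c1E *.
pose u (t : R) : R := clamp 0 1 (Num.min (3 * t) (3 - 3 * t)).
pose w (t : R) : R := clamp 0 1 (3 * t - 1).
have uw t : h (u t, w t) = spoke b (u t).
  have [t1|t1] := leP t (1 / 3).
    have -> : w t = 0.
      by rewrite /w /clamp min_l; [rewrite max_l //; lra|lra].
    by case: (hs (u t)).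
  have [t2|t2] := leP (2 / 3) t.
    have -> : w t = 1.
      by rewrite /w /clamp min_r; [rewrite max_r //; lra|lra].
    by case: (hs (u t)).
  have -> : u t = 1.
    rewrite /u /clamp [Num.min _ 1]min_r; first by rewrite max_r.
    by rewrite le_min; apply/andP; split; lra.
  by rewrite spoke1 h1 // clampP.
have cmul (k : R) : continuous (fun t : R => k * t).
  by move=> t; rewrite /continuous_at; apply: cvgM; [exact: cvg_cst|exact: cvg_id].
have cu : continuous u.
  move=> t; apply: (continuous_comp (f := fun t : R => Num.min (3 * t) (3 - 3 * t)));
    last exact: continuous_clamp.
  apply: (continuous_min (f := fun t : R => 3 * t)
    (g := fun t : R => 3 - 3 * t)); first exact: cmul.
  by rewrite /continuous_at; apply: cvgB; [exact: cvg_cst|exact: cmul].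
have cw : continuous w.
  move=> t; apply: (continuous_comp (f := fun t : R => 3 * t - 1));
    last exact: continuous_clamp.
  by rewrite /continuous_at; apply: cvgB; [exact: cmul|exact: cvg_cst].
(* (u t, w t) runs along the three sides, and h is the spoke at u t there. *)
pose K1 (q : R * R) := h (2 * q.1 * u q.2, (1 - 2 * q.1) * q.2 + 2 * q.1 * w q.2).
pose K2 (q : R * R) := spoke b ((2 - 2 * q.1) * u q.2).
pose K q := if q.1 <= 1 / 2 then K1 q else K2 q.
have cfst (k : R) : continuous (fun q : R * R => k * q.1).
  by move=> q; rewrite /continuous_at; apply: cvgM; [exact: cvg_cst|exact: cvg_fst].
have csnd (f : R -> R) : continuous f -> continuous (fun q : R * R => f q.2).
  by move=> cf q; apply: (continuous_comp (f := snd)); [exact: cvg_snd|exact: cf].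
have cK : continuous K.
  apply: continuous_paste.
  - by move=> q; exact: cvg_fst.
  - move=> q; apply: (continuous_comp (f := fun q : R * R =>
      (2 * q.1 * u q.2, (1 - 2 * q.1) * q.2 + 2 * q.1 * w q.2))); last exact: ch.
    apply: continuous_pair; rewrite /continuous_at.
      by apply: cvgM; [exact: cfst|exact: csnd].
    apply: cvgD; apply: cvgM; [|exact: cvg_snd|exact: cfst|exact: csnd].
    by apply: cvgB; [exact: cvg_cst|exact: cfst].
  - move=> q; apply: (continuous_comp (f := fun q : R * R => (2 - 2 * q.1) * u q.2));
      last exact: continuous_spoke.
    rewrite /continuous_at; apply: cvgM; last exact: csnd.
    by apply: cvgB; [exact: cvg_cst|exact: cfst].
  - move=> [s t] /= ->; rewrite /K1 /K2 /=.
    have -> : 2 * (1 / 2) = 1 :> R by field.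
    have -> : 2 - 1 = 1 :> R by ring.
    by rewrite subrr mul0r add0r !mul1r uw.
have u0 : u 0 = 0 by rewrite /u /clamp mulr0 subr0 !min_l // max_l.
have w0 : w 0 = 0 by rewrite /w /clamp mulr0 sub0r min_l ?max_l //; lra.
have u1 : u 1 = 0 by rewrite /u /clamp mulr1 subrr (min_r (ler0n _ 3)) min_l // max_l.
have w1 : w 1 = 1 by rewrite /w /clamp mulr1 min_r ?max_r //; lra.
exists K; split.
- exact: continuous_subspaceT.
- move=> t; rewrite in_itv /= => t01; rewrite /K /= divr_ge0 // /K1 /=.
  by rewrite !mulr0 !mul0r subr0 mul1r addr0 h0 // cE.
- move=> t; rewrite in_itv /= => t01; rewrite /K /= ifF; last first.
    by apply/negbTE; rewrite -ltNge; lra.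
  by rewrite /K2 /= mulr1 subrr mul0r spoke0.
- move=> s _; rewrite /K /= /K1 /K2 /= u0 u1 w0 w1 !mulr0 addr0 !mulr1 subrK.
  by case: (hs 0) => -> ->; rewrite spoke0 !if_same.
Qed.

End Loops.

(** * Passage times and winding of plane curves *)
Section Passage.
Variable R : realType.
Implicit Types (a b s t : R).

(** The supremum of the times at which u is at most r. *)
Lemma last_passage (u : R -> R) a b (r : R) : a <= b ->
  (forall s, a <= s <= b -> {for s, continuous u}) -> u a <= r -> r <= u b ->
  exists s, [/\ a <= s <= b, u s = r & forall t, s <= t <= b -> r <= u t].
Proof.
move=> ab cu ua ub.
pose S := [set s | a <= s <= b /\ u s <= r].
have Sa : S a by rewrite /S /= lexx ab.
have hS : has_sup S by split; [exists a|exists b => t [/andP[]]].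
have am : a <= sup S by apply: ub_le_sup => //; case: hS.
have mb : sup S <= b by apply: ge_sup; [exists a|move=> t [/andP[]]].
have cm : {for sup S, continuous u} by apply: cu; rewrite am.
have above t : sup S < t -> t <= b -> r < u t.
  move=> mt tb; rewrite ltNge; apply/negP => ut.
  suff : t <= sup S by rewrite leNgt mt.
  apply: ub_le_sup; first by case: hS.
  by split=> //; rewrite tb (le_trans am) // ltW.
have um : u (sup S) <= r.
  rewrite leNgt; apply/negP => h.
  have hN : \forall t \near sup S, r < u t by exact: (cvgr_gt _ cm _ h).
  have [e /= e0 he] := (nbhs_ballP _ _).1 hN.
  have [t St mt] := sup_adherent e0 hS; have ut := St.2.
  have tm : t <= sup S.
    by apply: ub_le_sup; [case: hS|].
  suff : r < u t by rewrite ltNge ut.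
  by apply: he; rewrite /ball /= ltr_distlC; apply/andP; split; lra.
have mr : r <= u (sup S).
  move: mb; rewrite le_eqVlt => /predU1P[-> //|mb].
  rewrite leNgt; apply/negP => h.
  have hN : \forall t \near sup S, u t < r by exact: (cvgr_lt _ cm _ h).
  have [e /= e0 he] := (nbhs_ballP _ _).1 hN.
  pose t := Num.min b (sup S + e / 2).
  have mt : sup S < t by rewrite lt_min mb ltrDl divr_gt0.
  have := above t mt; rewrite ge_min lexx => /(_ isT); rewrite ltNge => /negP; apply.
  apply/ltW/he; rewrite /ball /= ltr_distlC.
  have te : t <= sup S + e / 2 by rewrite ge_min lexx orbT.
  by apply/andP; split; lra.
exists (sup S); split; first by rewrite am.
  by apply/eqP; rewrite eq_le um.
move=> t /andP[]; rewrite le_eqVlt => /predU1P[<- //|mt] tb.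
exact/ltW/above.
Qed.

Lemma first_exit (T : topologicalType) (l : R -> T) (O D : set T) a b :
  a <= b -> (forall s, a <= s <= b -> {for s, continuous l}) ->
  open O -> closed D -> O `<=` D -> O (l a) -> ~ O (l b) ->
  exists2 s, a <= s <= b & ~ O (l s) /\ forall t, a <= t <= s -> D (l t).
Proof.
move=> ab cl oO cD OD Oa nOb.
pose S := [set s | a <= s <= b /\ forall t, a <= t <= s -> O (l t)].
have Sa : S a.
  by split; [rewrite lexx|move=> t; rewrite -eq_le => /eqP <-].
have hS : has_sup S by split; [exists a|exists b => t [/andP[]]].
have am : a <= sup S by apply: ub_le_sup => //; case: hS.
have mb : sup S <= b by apply: ge_sup; [exists a|move=> t [/andP[]]].
have cm : {for sup S, continuous l} by apply: cl; rewrite am.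
have below t : a <= t -> t < sup S -> O (l t).
  move=> at_ tm; have d0 : 0 < sup S - t by rewrite subr_gt0.
  have [s [_ hs] ts] := sup_adherent d0 hS.
  by apply: hs; rewrite at_ /=; move: ts; rewrite subKr => /ltW.
have nOm : ~ O (l (sup S)).
  move=> Om; have : nbhs (sup S) (l @^-1` O).
    by apply: cm; apply: open_nbhs_nbhs.
  move=> /nbhs_ballP[e /= e0 he].
  move: mb; rewrite le_eqVlt => /predU1P[mb|mb]; first by rewrite mb in Om.
  pose t := Num.min b (sup S + e / 2).
  have mt : sup S < t by rewrite lt_min mb ltrDl divr_gt0.
  have te : t <= sup S + e / 2 by rewrite ge_min lexx orbT.
  suff : t <= sup S by rewrite leNgt mt.
  apply: ub_le_sup; first by case: hS.
  split; first by rewrite (le_trans am (ltW mt)) ge_min lexx.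
  move=> s /andP[as_ st]; have [sm|ms] := ltP s (sup S); first exact: below.
  by apply: he; rewrite /ball /= ltr_distlC; apply/andP; split; lra.
exists (sup S); first by rewrite am.
split=> // t /andP[at_]; rewrite le_eqVlt => /predU1P[->|tm]; last first.
  by apply: OD; exact: below.
have {}am : a < sup S.
  by rewrite lt_neqAle am andbT; apply/eqP => e; apply: nOm; rewrite -e.
apply: contrapT => nD.
have : nbhs (sup S) (l @^-1` (~` D)).
  by apply: cm; apply: open_nbhs_nbhs; split => //; exact: closed_openC.
move=> /nbhs_ballP[e /= e0 he].
pose s := Num.max a (sup S - e / 2).
have sm : s < sup S by rewrite gt_max am; lra.
have es : sup S - e / 2 <= s by rewrite le_max lexx orbT.
apply: (he s); first by rewrite /ball /= ltr_distlC; apply/andP; split; lra.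
by apply: OD; apply: below => //; rewrite le_max lexx.
Qed.

Lemma continuous_on_segment (u : R -> R) a b :
  (forall s, a <= s <= b -> {for s, continuous u}) ->
  {within `[a, b], continuous u}.
Proof.
move=> cu; apply: continuous_in_subspaceT => s.
by rewrite inE /= in_itv /=; exact: cu.
Qed.

Lemma segment_ivt (u : R -> R) a b (v : R) : a <= b ->
  (forall s, a <= s <= b -> {for s, continuous u}) ->
  u a <= v <= u b \/ u b <= v <= u a -> exists2 s, a <= s <= b & u s = v.
Proof.
move=> ab /continuous_on_segment cu h.
have [|s] := @IVT _ u a b v ab cu.
  by case: h => /andP[h1 h2]; rewrite ge_min le_max ?h1 ?h2 ?orbT.
by rewrite in_itv /= => sab us; exists s.
Qed.

(** Such an interval contains a multiple of 2 pi. *)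
Lemma full_turn (u : R -> R) a b : a <= b ->
  (forall s, a <= s <= b -> {for s, continuous u}) -> u a + pi *+ 2 <= u b ->
  exists2 s, a <= s <= b & sin (u s) = 0 /\ cos (u s) = 1.
Proof.
move=> ab cu uab; set w := pi *+ 2 in uab.
have w0 : 0 < w by rewrite /w mulrn_wgt0 // pi_gt0.
(* N turns are added so that truncation, which sends negative numbers to 0, can
   be used to find the multiple. *)
pose N := (Num.truncn (`|u a| / w)).+1.
have hN : 0 <= u a + w *+ N.
  have : `|u a| / w < N%:R := truncnS_gt _.
  rewrite ltr_pdivrMr // mulrC mulr_natr => h.
  by have := ler_norm (- u a); rewrite normrN; lra.
pose n := (Num.truncn ((u a + w *+ N) / w)).+1.
have h1 : u a + w *+ N < w *+ n.
  have : (u a + w *+ N) / w < n%:R := truncnS_gt _.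
  by rewrite ltr_pdivrMr // mulrC mulr_natr.
have h2 : w *+ n <= u a + w *+ N + w.
  rewrite /n mulrSr lerD2r -mulr_natl -ler_pdivlMr //.
  by rewrite truncn_le divr_ge0 // ltW.
have [|s sab us] := segment_ivt ab cu (v := w *+ n - w *+ N).
  by left; apply/andP; split; lra.
exists s => //; rewrite us.
have e : w *+ n - w *+ N + w *+ N = 0 + w *+ n by rewrite subrK add0r.
split.
  rewrite -(periodicn (@sinD2pi R) N) e (periodicn (@sinD2pi R)); exact: sin0.
rewrite -(periodicn (@cosD2pi R) N) e (periodicn (@cosD2pi R)); exact: cos0.
Qed.

(** The curve z misses the upper or the lower half of the vertical axis,
    provided that it does not pass through the origin. *)
Definition half_avoiding (z : R -> R * R) a b : Prop :=
  (forall s, a <= s <= b -> (z s).1 = 0 -> (z s).2 <= 0) \/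
  (forall s, a <= s <= b -> (z s).1 = 0 -> 0 <= (z s).2).

(** The angle from the upper half of the vertical axis, by the half-angle
    formula; it is continuous off the lower half. *)
Definition bearing (z : R * R) : R := 2 * atan (z.1 / (enorm z + z.2)).

Lemma bearing_bound (z : R * R) : - pi < bearing z < pi.
Proof.
rewrite /bearing; set t := atan _.
have h1 : - (pi / 2) < t by exact: atan_gtNpi2.
have h2 : t < pi / 2 by exact: atan_ltpi2.
by apply/andP; split; lra.
Qed.

Lemma bearingE (z : R * R) : 0 < enorm z + z.2 ->
  z.1 = enorm z * sin (bearing z) /\ z.2 = enorm z * cos (bearing z).
Proof.
move=> d0; rewrite /bearing; set t := z.1 / _.
have dN : enorm z + z.2 != 0 by rewrite gt_eqF.
have h := sqr_enorm z; move: d0 dN h; rewrite /t.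
case: z {t} => p q /=; set n := enorm _ => d0 dN h; set t := p / (n + q).
have n0 : 0 <= n by exact: enorm_ge0.
have c2 : cos (atan t) ^+ 2 = (1 + t ^+ 2)^-1.
  by rewrite cos_atan exprVn sqr_sqrtr // addr_ge0 // sqr_ge0.
have cN : cos (atan t) != 0.
  by rewrite cos_atan invr_eq0 gt_eqF // sqrtr_gt0 ltr_pwDl // sqr_ge0.
have s_ : sin (atan t) = t * cos (atan t).
  by rewrite -{2}[t]atanK /tan mulfVK.
have D : 1 + t ^+ 2 = 2 * n / (n + q).
  have -> : 1 + t ^+ 2 = ((n + q) ^+ 2 + p ^+ 2) / (n + q) ^+ 2.
    by rewrite /t; field.
  have -> : (n + q) ^+ 2 + p ^+ 2 = 2 * n * (n + q).
    have -> : p ^+ 2 = n ^+ 2 - q ^+ 2 by rewrite h; ring.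
    by ring.
  by field.
have n1 : n != 0.
  apply/eqP => e; move: D; rewrite e mulr0 mul0r => D.
  by have := sqr_ge0 t; lra.
have c2' : cos (atan t) ^+ 2 = (n + q) / (2 * n).
  by rewrite c2 D; field; rewrite n1 dN.
rewrite (_ : 2 * atan t = atan t + atan t); last by ring.
rewrite sinD cosD s_ -!expr2.
have -> : n * (t * cos (atan t) * cos (atan t) + cos (atan t) * (t * cos (atan t)))
   = 2 * n * t * cos (atan t) ^+ 2 by ring.
have -> : n * (cos (atan t) ^+ 2 - (t * cos (atan t)) ^+ 2)
   = n * (2 - (1 + t ^+ 2)) * cos (atan t) ^+ 2 by ring.
by rewrite c2' D /t; split; field; rewrite ?n1 ?dN.
Qed.

Lemma turn_bound (p x y v w : R) : - p < x < p -> - p < y < p ->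
  w + p *+ 4 <= v -> x - v + p *+ 2 <= y - w.
Proof.
by rewrite -[p *+ 4]mulr_natl -[p *+ 2]mulr_natl => /andP[? ?] /andP[? ?] ?; lra.
Qed.

(** The bearing of z stays within (- pi, pi) while the rotation makes two turns,
    so the bearing of the rotated curve makes a full turn and takes both
    vertical directions. *)
Lemma rot_not_half_avoiding (z : R -> R * R) (th : R -> R) a b : a <= b ->
  (forall s, a <= s <= b -> {for s, continuous z}) ->
  (forall s, a <= s <= b -> {for s, continuous th}) ->
  (forall s, a <= s <= b -> 0 < enorm (z s)) ->
  th b + pi *+ 4 <= th a ->
  (forall s, a <= s <= b -> (z s).1 = 0 -> 0 <= (z s).2) ->
  ~ half_avoiding (fun s => rot (th s) (z s)) a b.
Proof.
move=> ab cz cth z0 thab hz.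
have d0 s : a <= s <= b -> 0 < enorm (z s) + (z s).2.
  move=> sab; have n0 := z0 _ sab; have := normr2_enorm (z s).
  rewrite ler_norml => /andP[h1 _]; rewrite lt_neqAle andbC.
  apply/andP; split; first by lra.
  apply/negP => /eqP e.
  have z1 : (z s).1 = 0.
    have := sqr_enorm (z s); have -> : enorm (z s) = - (z s).2 by lra.
    rewrite sqrrN -[LHS]add0r => /addIr /esym/eqP; by rewrite sqrf_eq0 => /eqP.
  by have := hz _ sab z1; lra.
pose psi s := bearing (z s) - th s.
have cpsi s : a <= s <= b -> {for s, continuous psi}.
  move=> sab; rewrite /continuous_at; apply: cvgB; last exact: cth.
  apply: cvgM; first exact: cvg_cst.
  have c1 : {for s, continuous (fun s => (z s).1)}.
    by apply: (continuous_comp (cz _ sab)); exact: cvg_fst.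
  have c2 : {for s, continuous (fun s => (z s).2)}.
    by apply: (continuous_comp (cz _ sab)); exact: cvg_snd.
  apply: (continuous_comp (f := fun s => (z s).1 / (enorm (z s) + (z s).2)));
    last exact: continuous_atan.
  rewrite /continuous_at; apply: cvgM => //; apply: cvgV.
    by rewrite gt_eqF // d0.
  apply: cvgD => //; apply: (continuous_comp (cz _ sab)).
  exact: continuous_enorm.
have turn : psi a + pi *+ 2 <= psi b.
  exact: turn_bound (bearing_bound _) (bearing_bound _) thab.
have rotE s : a <= s <= b ->
    rot (th s) (z s) = (enorm (z s) * sin (psi s), enorm (z s) * cos (psi s)).
  move=> sab; have [e1 e2] := bearingE (d0 _ sab).
  rewrite /rot e1 e2 /psi sinB cosB.
  by congr (_, _); ring.
case=> h.
  have [s sab [s0 c1]] := full_turn ab cpsi turn.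
  have := h s sab; rewrite rotE //= s0 c1 mulr0 mulr1 => /(_ erefl).
  by rewrite leNgt z0.
have cpsi' s : a <= s <= b -> {for s, continuous (fun s => psi s - pi)}.
  by move=> sab; rewrite /continuous_at; apply: cvgB; [exact: cpsi|exact: cvg_cst].
have [|s sab [s0 c1]] := full_turn ab cpsi'; first by lra.
have := h s sab; rewrite rotE //= -[psi s](subrK pi) sinDpi cosDpi s0 c1.
rewrite oppr0 mulr0 mulrN1 => /(_ erefl).
by rewrite oppr_ge0 leNgt z0.
Qed.

Lemma twisted_not_half_avoiding (z : R -> R * R) (th : R -> R) a b : a <= b ->
  (forall s, a <= s <= b -> {for s, continuous z}) ->
  (forall s, a <= s <= b -> {for s, continuous th}) ->
  (forall s, a <= s <= b -> 0 < enorm (z s)) ->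
  th b + pi *+ 4 <= th a ->
  half_avoiding z a b -> ~ half_avoiding (fun s => rot (th s) (z s)) a b.
Proof.
move=> ab cz cth z0 thab [] hz; last exact: rot_not_half_avoiding.
(* The central symmetry commutes with rotations and exchanges the two halves. *)
pose z' s := (- (z s).1, - (z s).2).
have cz' s : a <= s <= b -> {for s, continuous z'}.
  move=> sab; apply: continuous_pair; rewrite /continuous_at; apply: cvgN;
    apply: (continuous_comp (cz _ sab)); [exact: cvg_fst|exact: cvg_snd].
have n' s : enorm (z' s) = enorm (z s) by rewrite /enorm /= !sqrrN.
have := @rot_not_half_avoiding z' th a b ab cz' cth.
have h1 s : a <= s <= b -> 0 < enorm (z' s) by rewrite n'; exact: z0.
have h2 s : a <= s <= b -> (z' s).1 = 0 -> 0 <= (z' s).2.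
  by move=> sab /eqP; rewrite oppr_eq0 oppr_ge0 => /eqP; exact: hz.
move=> /(_ h1 thab h2) h hz'; apply: h.
have e s : rot (th s) (z' s) = (- (rot (th s) (z s)).1, - (rot (th s) (z s)).2).
  by rewrite /rot /z' /=; congr (_, _); ring.
case: hz' => k; [right|left] => s sab; rewrite e => /= /eqP;
  rewrite oppr_eq0 ?oppr_ge0 ?oppr_le0 => /eqP; exact: k.
Qed.

End Passage.

(** * Following a plaque out of a compact set *)
Section Plaques.
Variables (R : realType) (T : topologicalType).
Local Notation E := (R * 'rV[R]_1)%type.
Implicit Types (c : set T * (T -> E)).

Lemma foliated_chart_continuous c p : foliated_chart c -> c.1 p ->
  {for p, continuous c.2}.
Proof.
move=> [oc [B _ [_ cc _]]] cp.
rewrite continuous_open_subspace // in cc.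
by apply: cc; rewrite inE.
Qed.

(** If the half of the plaque beyond p0 stayed in D, its coordinate would reach
    a maximum on the compact set D, but it ranges over an open interval. *)
Lemma plaque_exit c (D : set T) p0 : foliated_chart c -> compact D ->
  D `<=` c.1 -> D p0 ->
  exists (l : R -> T) (s0 s1 : R), [/\ s0 <= s1, l s0 = p0, ~ D (l s1)
    & forall s, s0 <= s <= s1 ->
        [/\ {for s, continuous l}, c.1 (l s) & c.2 (l s) = (s, (c.2 p0).2)]].
Proof.
move=> fc cD Dc Dp0; have cp0 := Dc _ Dp0.
have [oc [B [I [J [[oI oJ] [iI iJ] _ BE]]] [[cB cinj csurj] cc [g cg gK]]]] := fc.
set s0 := (c.2 p0).1; set y0 := (c.2 p0).2.
have Bp p : c.1 p -> B (c.2 p) by apply: cB.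
have Is0 : I s0 by have := Bp _ cp0; rewrite BE => -[].
have Bs s : I s -> B (s, y0).
  by move=> Is; have := Bp _ cp0; rewrite BE => -[_ h]; split.
pose l s := g (s, y0).
have cl s : I s -> c.1 (l s) /\ c.2 (l s) = (s, y0).
  move=> Is; have [q cq e] := csurj _ (Bs _ Is).
  by rewrite /l -e gK // inE.
have ll s : I s -> {for s, continuous l}.
  move=> Is; have /subspace_continuousP := cg.
  move=> /(_ _ (Bs _ Is)) h N /h hN.
  have cp : {for s, continuous (fun t : R => (t, y0))}.
    by apply: continuous_pair; [exact: cvg_id|exact: cvg_cst].
  have h2 : \forall t \near s, B (t, y0) -> N (g (t, y0)) by exact: (cp _ hN).
  have h3 : \forall t \near s, I t by apply: open_nbhs_nbhs.
  rewrite /= nbhs_simpl /=; apply: filterS2 h2 h3 => t /= k It.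
  exact: k (Bs _ It).
have [s1 [Is1 s01 nD]] : exists s1, [/\ I s1, s0 <= s1 & ~ D (l s1)].
  apply: contrapT => hno.
  have hD s : I s -> s0 <= s -> D (l s).
    by move=> Is s0s; apply: contrapT => nD; apply: hno; exists s.
  have [|pm Dm hm] := @compact_EVT_max T R (fun p => (c.2 p).1) D
    (ex_intro _ p0 Dp0) cD.
    apply: continuous_in_subspaceT => p; rewrite inE => Dp.
    apply: (continuous_comp (foliated_chart_continuous fc (Dc _ Dp))).
    exact: cvg_fst.
  rewrite inE in Dm; set m := (c.2 pm).1 in hm.
  have Im : I m by have := Bp _ (Dc _ Dm); rewrite BE => -[].
  have s0m : s0 <= m by apply: hm; rewrite inE.
  have : nbhs m I by apply: open_nbhs_nbhs.
  move=> /nbhs_ballP[e /= e0 he].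
  have Ie : I (m + e / 2).
    by apply: he; rewrite /ball /= ltr_distlC; apply/andP; split; lra.
  have := hm (l (m + e / 2)); rewrite inE (cl _ Ie).2 /=.
  by move=> /(_ (hD _ Ie _)); rewrite -subr_ge0; lra.
exists l, s0, s1; split => //.
  rewrite /l /s0 /y0 -surjective_pairing; apply: gK; by rewrite inE.
move=> s /andP[ss s1s].
have Is : I s by apply: (iI _ _ Is0 Is1); rewrite ss.
by have [h1 h2] := cl _ Is; split => //; exact: ll.
Qed.

End Plaques.

(** * Plaques near a seam *)
Section Rigidity.
Variable R : realType.
Local Notation E := (R * 'rV[R]_1)%type.
Implicit Types (P v z : R * R) (x : nat -> bool).
Implicit Types (c : set (moore R) * (moore R -> E)).

Definition one_nneg : {a : R | 0 <= a} := exist _ 1 ler01.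

Lemma chart_csquare10 x : chart x (csquare (1, 0)) = Seam x one_nneg.
Proof.
have -> : csquare (1, 0) = unchart x (Seam x one_nneg).
  by rewrite /csquare /=; congr (_, _); ring.
by rewrite unchartK.
Qed.

Lemma inv_nat_lt (e : R) : 0 < e -> exists n : nat, n.+1%:R^-1 < e.
Proof.
move=> e0; exists (Num.truncn e^-1).
by rewrite invf_plt ?posrE ?invr_gt0 //; exact: truncnS_gt.
Qed.

(** The absolute value of the real part of a square root; unlike the real part
    itself it is continuous across the seam. *)
Definition abs_root v : R := Num.sqrt ((enorm v + v.1) / 2).

Lemma abs_root_csquare z : 0 <= z.2 -> abs_root (csquare z) = `|z.1|.
Proof.
move=> z0; rewrite -sqrtr_sqr /abs_root; congr Num.sqrt.
have := sqr_height (csquare z); rewrite height_csquare // => h.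
have -> : enorm (csquare z) = 2 * z.2 ^+ 2 + (csquare z).1 by rewrite h; field.
by rewrite /csquare /=; field.
Qed.

Lemma continuous_abs_root v : {for v, continuous abs_root}.
Proof.
apply: (continuous_comp (f := fun v => (enorm v + v.1) / 2) (g := Num.sqrt));
  last exact: sqrt_continuous.
rewrite /continuous_at; apply: cvgM; last exact: cvg_cst.
by apply: cvgD; [exact: continuous_enorm|exact: cvg_fst].
Qed.

(** The half rectangle of size r at (1, 0) is in the domain of c, and its points
    that lie on a plaque, between two points of the axis m = 1 of height at most
    d, are at distance less than r / 4 from the axis. Here (1, 0) is on the
    boundary of the half plane, that is on the seam. *)
Definition adapted x c (r d : R) : Prop :=
  (forall m y : R, `|m - 1| <= r -> 0 <= y <= r -> c.1 (chart x (csquare (m, y)))) /\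
  (forall y y' m w : R, 0 <= y <= d -> 0 <= y' <= d -> `|m - 1| <= r ->
     0 <= w <= r ->
     let e q := c.2 (chart x (csquare q)) in
     (e (1, y)).2 = (e (m, w)).2 -> (e (1, y')).2 = (e (m, w)).2 ->
     (e (1, y)).1 <= (e (m, w)).1 <= (e (1, y')).1 -> `|m - 1| < r / 4).

(** Along the axis the coordinates of c tend to those of the seam point. So do
    the coordinates of a point between two points of the axis on the same
    plaque, and the inverse of the chart is continuous. Reciprocals of integers
    are taken so that only countably many constants occur. *)
Lemma adapted_exists x c : foliated_chart c -> c.1 (Seam x one_nneg) ->
  exists n n' : nat, adapted x c n.+2%:R^-1 n'.+1%:R^-1.
Proof.
move=> fc cx; have [oc [B _ [[cB _ _] _ [g cg gK]]]] := fc.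
pose h (q : R * R) := chart x (csquare q).
have ch q : {for q, continuous h}.
  by apply: continuous_comp; [exact: continuous_csquare|exact: continuous_chart].
have h10 : h (1, 0) = Seam x one_nneg := chart_csquare10 x.
have [n hn] : exists n : nat, forall m y : R, `|m - 1| <= n.+2%:R^-1 ->
    0 <= y <= n.+2%:R^-1 -> c.1 (h (m, y)).
  have : nbhs ((1, 0) : R * R) (h @^-1` c.1).
    by apply: ch; rewrite h10; apply: open_nbhs_nbhs.
  move=> /nbhs_ballP[e /= e0 he]; have [n ne] := inv_nat_lt e0.
  have ne' : n.+2%:R^-1 < e.
    by apply: le_lt_trans ne; rewrite lef_pV2 ?posrE // ler_nat.
  exists n => m y my /andP[y0 yn]; apply: he; split; rewrite /ball /=.
    by rewrite distrC; apply: le_lt_trans ne'.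
  by rewrite sub0r normrN ger0_norm //; apply: le_lt_trans ne'.
exists n; set r : R := n.+2%:R^-1.
have r0 : 0 < r by rewrite invr_gt0.
have r1 : r <= 1 / 2 by rewrite mul1r /r lef_pV2 ?posrE // ler_nat.
(* Through the fold, points with m near 1 and points with m near -1 are close to
   each other, hence the absolute value. *)
pose N := [set p | in_chart x p /\ `|abs_root (unchart x p) - 1| < r / 4].
have nN : nbhs (h (1, 0)) N.
  apply: filterI.
    by apply: open_nbhs_nbhs; split; [exact: open_in_chart|exact: chart_in].
  have cu : {for h (1, 0), continuous (fun p => abs_root (unchart x p))}.
    apply: (continuous_comp (f := unchart x)); last exact: continuous_abs_root.
    by apply: continuous_unchart; exact: chart_in.
  have e1 : abs_root (unchart x (h (1, 0))) = 1.
    by rewrite /h chartK abs_root_csquare //= normr1.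
  have : nbhs (abs_root (unchart x (h (1, 0)))) [set t | `|t - 1| < r / 4].
    rewrite e1; apply/nbhs_ballP; exists (r / 4) => /=; first by rewrite divr_gt0.
    by move=> t; rewrite /ball /= distrC.
  by move=> /cu.
have c10 : c.1 (h (1, 0)) by rewrite h10.
have : within B (nbhs (c.2 (h (1, 0)))) (g @^-1` N).
  have ge : g (c.2 (h (1, 0))) = h (1, 0) by rewrite gK ?inE.
  have /subspace_continuousP/(_ _ (cB _ c10)) := cg.
  by rewrite /from_subspace ge; apply.
move=> /nbhs_ballP[e /= e0 he].
have : nbhs ((1, 0) : R * R) ((fun q => c.2 (h q)) @^-1` ball (c.2 (h (1, 0))) e).
  have := @continuous_comp _ _ _ h c.2 (1, 0) (ch _)
    (foliated_chart_continuous fc c10).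
  by apply; exact: nbhsx_ballx.
move=> /nbhs_ballP[d /= d0 hd]; have [n' nd] := inv_nat_lt d0.
exists n'; split; first exact: hn.
have near0 y : 0 <= y <= n'.+1%:R^-1 -> ball (c.2 (h (1, 0))) e (c.2 (h (1, y))).
  move=> /andP[y0 yn]; apply: hd; split => /=; first exact: ballxx.
  by rewrite /ball /= sub0r normrN ger0_norm //; apply: le_lt_trans nd.
move=> y y' m w yd y'd mr zr /= e1 e2 e12.
have [a1 a2] := near0 _ yd; have [b1 b2] := near0 _ y'd.
have cmz : c.1 (h (m, w)) by exact: hn.
have : ball (c.2 (h (1, 0))) e (c.2 (h (m, w))).
  split; last by rewrite -e1.
  move: a1 b1; rewrite /ball /= !ltr_distlC => /andP[h1 _] /andP[_ h2].
  have {}e12 : (c.2 (h (1, y))).1 <= (c.2 (h (m, w))).1 <= (c.2 (h (1, y'))).1.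
    exact: e12.
  case/andP: e12 => h3 h4.
  by rewrite (lt_le_trans h1 h3) (le_lt_trans h4 h2).
move=> /he/(_ (cB _ cmz)); rewrite /= gK ?inE // => -[_].
have w0 : 0 <= w by case/andP: zr.
rewrite /h chartK abs_root_csquare //= [`|m|]ger0_norm //.
by move: mr; rewrite ler_norml => /andP[? _]; lra.
Qed.

(** The half plane, in the coordinates of the chart x. *)
Definition embed x P : moore R := Inner (weld x P).

Lemma embedE x P : embed x P = chart x (slit_point P).
Proof. by rewrite /chart (negbTE (slit_point_off_slit _)) slit_pointK. Qed.

Lemma embedK x P : unweld x (inner (embed x P)) = P.
Proof. exact: weldK. Qed.

Lemma continuous_embed x : continuous (embed x).
Proof.
move=> P; apply: (continuous_comp (f := weld x)); first exact: continuous_weld.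
exact: continuous_Inner.
Qed.

Lemma open_embed x (U : set (R * R)) : open U -> open (embed x @` U).
Proof.
move=> oU; have -> : embed x @` U = @Inner R @` (unweld x @^-1` U).
  apply/seteqP; split => _ [P UP <-].
    by exists (weld x P) => //=; rewrite weldK.
  by exists (unweld x P) => //; rewrite /embed unweldK.
apply: open_Inner; apply: open_comp => // z _.
exact: continuous_unweld.
Qed.

Definition disc k (r : R) : set (R * R) := [set P | enorm (cell k P) <= r].

Lemma compact_disc k r : compact (disc k r).
Proof.
apply: (@subclosed_compact _ _
  (`[1 - r, 1 + r]%classic `*`
   `[(2 * k%:R + 1 - r) / 2, (2 * k%:R + 1 + r) / 2]%classic)).
- have -> : disc k r = (@enorm R \o cell k) @^-1` [set t | t <= r] by [].
  apply: preimage_closed; last exact: closed_le.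
  move=> P; rewrite inE => _.
  by apply: continuous_comp; [exact: continuous_cell|exact: continuous_enorm].
- by apply: compact_setX; exact: segment_compact.
- move=> P /= hP; have h1 := le_trans (normr1_enorm _) hP.
  have h2 := le_trans (normr2_enorm _) hP.
  move: h1 h2; rewrite /cell /= !ler_norml => /andP[? ?] /andP[? ?].
  by rewrite !in_itv /=; split; apply/andP; split; lra.
Qed.

Lemma disc_bounds k r P : disc k r P -> r < 1 ->
  [/\ `|P.1 - 1| <= r, k%:R <= P.2 < k.+1%:R
    & 0 <= expR (- P.2) <= expR (- k%:R)].
Proof.
move=> hP r1; have h1 := le_trans (normr1_enorm _) hP.
have /cell_lt1/andP[h2 h3] := le_lt_trans hP r1.
split => //; first by rewrite (ltW h2) h3.
by rewrite expR_ge0 ler_expR lerN2 ltW.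
Qed.

Definition monotone_on (u : R -> R) (a b : R) : Prop :=
  (forall s t, a <= s -> s <= t -> t <= b -> u s <= u t) \/
  (forall s t, a <= s -> s <= t -> t <= b -> u t <= u s).

(** Between two passages through the axis, the first disc coordinate is less
    than r / 4 while the distance to the centre is at least r / 2. So the second
    coordinate keeps its sign, and the passages are on the same half. *)
Lemma plaque_half_avoiding x c (r d : R) k (l : R -> moore R)
    (gam : R -> R * R) (a b : R) y0 :
  adapted x c r d -> 0 < r < 1 -> expR (- k%:R) <= r -> expR (- k%:R) <= d ->
  (forall s, a <= s <= b -> [/\ {for s, continuous gam}, l s = embed x (gam s),
     r / 2 <= enorm (cell k (gam s)) <= r & (c.2 (l s)).2 = y0]) ->
  monotone_on (fun s => (c.2 (l s)).1) a b ->
  half_avoiding (fun s => cell k (gam s)) a b.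
Proof.
move=> [_ ad] /andP[r0 r1] kr kd hgam mono.
have cz s : a <= s <= b -> {for s, continuous (fun s => cell k (gam s))}.
  move=> /hgam[cs _ _ _]; apply: (continuous_comp cs); exact: continuous_cell.
have axis s1 s2 s : a <= s1 -> s1 <= s -> s <= s2 -> s2 <= b ->
    (cell k (gam s1)).1 = 0 -> (cell k (gam s2)).1 = 0 ->
    `|(cell k (gam s)).1| < r / 4.
  move=> as1 s1s ss2 s2b z1 z2.
  have in1 : a <= s1 <= b by rewrite as1 (le_trans s1s (le_trans ss2 s2b)).
  have in2 : a <= s2 <= b by rewrite s2b (le_trans as1 (le_trans s1s ss2)).
  have in0 : a <= s <= b by rewrite (le_trans as1 s1s) (le_trans ss2 s2b).
  have pt t : a <= t <= b -> [/\ `|(gam t).1 - 1| <= r,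
      0 <= expR (- (gam t).2) <= expR (- k%:R)
    & l t = chart x (csquare ((gam t).1, expR (- (gam t).2)))].
    move=> /hgam[_ lt_ /andP[_ ht] _]; have [h1 _ h3] := disc_bounds ht r1.
    by split => //; rewrite lt_ embedE.
  have on1 t : (cell k (gam t)).1 = 0 -> (gam t).1 = 1.
    by rewrite /cell /= => /eqP; rewrite subr_eq0 => /eqP.
  have [_ /andP[p1 q1] l1] := pt _ in1; rewrite (on1 _ z1) in l1.
  have [_ /andP[p2 q2] l2] := pt _ in2; rewrite (on1 _ z2) in l2.
  have [m0 /andP[p0 q0] l0] := pt _ in0.
  have [_ _ _ e1] := hgam _ in1; have [_ _ _ e2] := hgam _ in2.
  have [_ _ _ e0] := hgam _ in0.
  have i1 : 0 <= expR (- (gam s1).2) <= d by rewrite p1 (le_trans q1).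
  have i2 : 0 <= expR (- (gam s2).2) <= d by rewrite p2 (le_trans q2).
  have i0 : 0 <= expR (- (gam s).2) <= r by rewrite p0 (le_trans q0).
  case: mono => mono.
    apply: (ad _ _ _ _ i1 i2 m0 i0) => /=; rewrite -l0 -?l1 -?l2 ?e0 ?e1 ?e2 //.
    by apply/andP; split; apply: mono => //; case/andP: in0.
  apply: (ad _ _ _ _ i2 i1 m0 i0) => /=; rewrite -l0 -?l1 -?l2 ?e0 ?e1 ?e2 //.
  by apply/andP; split; apply: mono => //; case/andP: in0.
have no s1 s2 : a <= s1 -> s1 <= s2 -> s2 <= b ->
    (cell k (gam s1)).1 = 0 -> (cell k (gam s2)).1 = 0 ->
    (cell k (gam s1)).2 <= 0 <= (cell k (gam s2)).2 \/
    (cell k (gam s2)).2 <= 0 <= (cell k (gam s1)).2 -> False.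
  move=> as1 s12 s2b z1 z2 sg.
  have [|s /andP[s1s ss2] zs] :=
      @segment_ivt R (fun s => (cell k (gam s)).2) s1 s2 0 s12 _ sg.
    move=> s /andP[s1s ss2].
    have sab : a <= s <= b by rewrite (le_trans as1 s1s) (le_trans ss2).
    by apply: (continuous_comp (cz _ sab)); exact: cvg_snd.
  have sab : a <= s <= b by rewrite (le_trans as1 s1s) (le_trans ss2).
  have := axis _ _ _ as1 s1s ss2 s2b z1 z2.
  have [_ _ /andP[+ _] _] := hgam _ sab.
  rewrite /enorm zs expr0n addr0 sqrtr_sqr; lra.
apply: contrapT => /not_orP[] /existsNP[s1] /not_implyP[in1] /not_implyP[z1].
move=> /negP; rewrite -ltNge => p1.
move=> /existsNP[s2] /not_implyP[in2] /not_implyP[z2] /negP; rewrite -ltNge => p2.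
case/andP: in1 => ? ?; case/andP: in2 => ? ?.
have [s12|/ltW s21] := leP s1 s2.
  by apply: (no s1 s2) => //; right; rewrite !ltW.
by apply: (no s2 s1) => //; left; rewrite !ltW.
Qed.

End Rigidity.

(** * Two sequences differing by one twist *)
Section Conflict.
Variable R : realType.
Local Notation E := (R * 'rV[R]_1)%type.
Implicit Types (P v z : R * R) (x : nat -> bool).
Implicit Types (c : set (moore R) * (moore R -> E)).

Lemma disc_in_domain x c (r d : R) k P : adapted x c r d -> r < 1 ->
  expR (- k%:R) <= r -> disc k r P -> c.1 (embed x P).
Proof.
move=> [ad _] r1 kr hP; have [h1 _ /andP[h2 h3]] := disc_bounds hP r1.
by rewrite embedE; apply: ad => //; rewrite h2 (le_trans h3).
Qed.

(** The transverse coordinate of the second chart is locally a function of that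
    of the first one. *)
Lemma transverse_constant (T : topologicalType) (c c' : set T * (T -> E))
    (l : R -> T) (a b : R) y0 : a <= b -> foliated_change c c' ->
  (forall s, a <= s <= b -> [/\ {for s, continuous l}, c.1 (l s), c'.1 (l s)
     & c.2 (l s) = (s, y0)]) ->
  forall s, a <= s <= b -> (c'.2 (l s)).2 = (c'.2 (l a)).2.
Proof.
move=> ab cc' hl s /andP[as_ sb].
pose same (u v : R) := (c'.2 (l v)).2 = (c'.2 (l u)).2.
suff : same a s by [].
apply: interval_induction => //; first by move=> u v w _ _; rewrite /same => <-.
move=> t /andP[at_ ts]; have tab : a <= t <= b by rewrite at_ (le_trans ts).
have [lt_ ct c't et] := hl _ tab.
have [f [g fg]] := cc' _ (conj ct c't).
have : \forall u \near t, c'.2 (l u) = (f (c.2 (l u)), g (c.2 (l u)).2).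
  exact: (lt_ _ fg).
move=> /nbhs_ballP[e /= e0 he]; exists e => // u v au uv vs tu vt.
have h w : a <= w -> w <= s -> t - e < w -> w < t + e -> (c'.2 (l w)).2 = g y0.
  move=> aw ws tw wt; rewrite he; last by rewrite /ball /= ltr_distlC tw.
  have wab : a <= w <= b by rewrite aw (le_trans ws).
  by have [_ _ _ ->] := hl w wab.
rewrite /same !h //.
- exact: le_trans uv vs.
- exact: le_lt_trans uv vt.
- exact: le_trans au uv.
- exact: lt_le_trans tu uv.
Qed.

Lemma injective_monotone (u : R -> R) (a b : R) : a <= b ->
  (forall s, a <= s <= b -> {for s, continuous u}) ->
  (forall s t, a <= s <= b -> a <= t <= b -> u s = u t -> s = t) ->
  monotone_on u a b.
Proof.
move=> ab cu iu; have cw := continuous_on_segment cu.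
have iw : {in `[a, b] &, injective u}.
  by move=> s t; rewrite !in_itv /=; exact: iu.
have io s t : a <= s -> s <= t -> t <= b -> s \in `[a, b] /\ t \in `[a, b].
  move=> as_ st tb; rewrite !in_itv /= as_ tb (le_trans st tb).
  by rewrite (le_trans as_ st).
have [h|/ltW h] := leP (u a) (u b).
  left=> s t as_ st tb; have [si ti] := io _ _ as_ st tb.
  by rewrite (segment_continuous_inj_le h cw iw).
right=> s t as_ st tb; have [si ti] := io _ _ as_ st tb.
by rewrite (segment_continuous_inj_ge h cw iw).
Qed.

(** A plaque of c through the centre of the k-th disc has to leave the disc of
    radius r. On its last way from radius r / 2 to radius r it is also a curve
    in a plaque of c', where it appears twisted, and both versions miss half of
    the axis. *)
Lemma twist_conflict x x' c c' (r d : R) k :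
  foliated_chart c -> foliated_chart c' -> foliated_change c c' ->
  adapted x c r d -> adapted x' c' r d -> 0 < r < 1 ->
  expR (- k%:R) <= r -> expR (- k%:R) <= d -> pi *+ 4 <= k%:R * (r / 2) ->
  (forall j, (j < k)%N -> x j = x' j) -> x k = true -> x' k = false -> False.
Proof.
move=> fc fc' cc' ac ac' r01 kr kd turns xx' xk x'k.
have /andP[r0 r1] := r01.
pose P0 : R * R := uncell k (0, 0).
have nP0 : enorm (cell k P0) = 0.
  by rewrite uncellK /enorm /= expr0n addr0 sqrtr0.
pose D := embed x @` disc k r.
have cD : compact D.
  apply: continuous_compact; last exact: compact_disc.
  by apply: continuous_subspaceT; exact: continuous_embed.
have Dc : D `<=` c.1 by move=> _ [P hP <-]; exact: (disc_in_domain ac r1 kr hP).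
have DP0 : D (embed x P0).
  exists P0 => //.
  by rewrite -[disc k r P0]/(is_true (enorm (cell k P0) <= r)) nP0 ltW.
have [l [s0 [s1 [s01 l0 nD hl]]]] := plaque_exit fc cD Dc DP0.
pose O := embed x @` [set P | enorm (cell k P) < r].
have oO : open O.
  apply: open_embed.
  rewrite -[X in open X]/((@enorm R \o cell k) @^-1` [set t | t < r]).
  apply: open_comp; last exact: open_lt.
  move=> P _; apply: continuous_comp; first exact: continuous_cell.
  exact: continuous_enorm.
have OD : O `<=` D by move=> _ [P hP <-]; exists P => //; exact: ltW.
have hlc s : s0 <= s <= s1 -> {for s, continuous l} by move=> /hl[].
have O0 : O (l s0).
  rewrite l0; exists P0 => //.
  by change (is_true (enorm (cell k P0) < r)); rewrite nP0.
have nO1 : ~ O (l s1) by move=> /OD.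
have cDl := compact_closed (@hausdorff_moore R) cD.
(* b is the time of the first exit from the open disc of radius r, and a that of
   the last passage at radius r / 2 before b. *)
have [b /andP[s0b bs1] [nOb Db]] := first_exit s01 hlc oO cDl OD O0 nO1.
pose gam s := unweld x (inner (l s)).
have hgam s : s0 <= s <= b -> [/\ {for s, continuous gam}, l s = embed x (gam s)
    & enorm (cell k (gam s)) <= r].
  move=> sb; have [P hP e] := Db _ sb.
  have eP : gam s = P by rewrite /gam -e embedK.
  rewrite eP -e; split => //.
  have ls : {for s, continuous l}.
    by apply: hlc; case/andP: sb => -> /le_trans ->.
  apply: (continuous_comp (f := @inner R \o l) (g := unweld x));
    last exact: continuous_unweld.
  by apply: continuous_comp => //; rewrite -e; exact: continuous_inner.
pose u s := enorm (cell k (gam s)).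
have cu s : s0 <= s <= b -> {for s, continuous u}.
  move=> /hgam[cs _ _]; apply: (continuous_comp (f := cell k \o gam) (g := @enorm R)).
    by apply: continuous_comp => //; exact: continuous_cell.
  exact: continuous_enorm.
have ub : u b = r.
  have [|_ lb] := hgam b; first by rewrite s0b lexx.
  rewrite -/(u b) le_eqVlt => /predU1P[//|hb].
  by case: nOb; exists (gam b).
have u0 : u s0 <= r / 2.
  have -> : u s0 = 0.
    by rewrite /u /gam l0 embedK nP0.
  by rewrite divr_ge0 // ltW.
have [|a [/andP[s0a ab] ua hu]] := last_passage s0b cu u0.
  by rewrite ub ler_pdivrMr // ler_peMr ?ler1n // ltW.
have sub s : a <= s <= b -> s0 <= s <= b.
  by move=> /andP[as_ ->]; rewrite (le_trans s0a as_).
have sub1 s : a <= s <= b -> s0 <= s <= s1.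
  by move=> /sub/andP[-> sb]; exact: le_trans sb bs1.
pose y0 := (c.2 (embed x P0)).2.
have lE s : a <= s <= b -> l s = embed x' (twist k 1 (gam s)).
  move=> /sub/hgam[_ -> hr]; rewrite /embed; congr Inner.
  by apply: weld_agree => //; have [_ ->] := disc_bounds hr r1.
have c'l s : a <= s <= b -> c'.1 (l s).
  move=> sab; rewrite lE //; apply: (disc_in_domain ac' r1 kr).
  change (is_true (enorm (cell k (twist k 1 (gam s))) <= r)).
  by rewrite enorm_twist; have [] := hgam _ (sub _ sab).
have c'const := @transverse_constant _ c c' l a b y0 ab cc' _.
have {}c'const s : a <= s <= b -> (c'.2 (l s)).2 = (c'.2 (l a)).2.
  apply: c'const => t tab; have [h1 h2 h3] := hl _ (sub1 _ tab).
  by split => //; exact: c'l.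
(* Injective, since the curve lies in a single plaque of c'. *)
have mono' : monotone_on (fun s => (c'.2 (l s)).1) a b.
  apply: injective_monotone => // [s sab|s t sab tab e].
    apply: (continuous_comp (f := c'.2 \o l) (g := fst)); last exact: cvg_fst.
    apply: continuous_comp; first exact: hlc (sub1 _ sab).
    by apply: foliated_chart_continuous => //; exact: c'l.
  have [oc' [B' _ [[_ cinj _] _ _]]] := fc'.
  have ll : l s = l t.
    apply: cinj; rewrite ?inE; [exact: c'l|exact: c'l|].
    rewrite [LHS]surjective_pairing [RHS]surjective_pairing e.
    by rewrite (c'const _ sab) (c'const _ tab).
  have [_ _ es] := hl _ (sub1 _ sab); have [_ _ et] := hl _ (sub1 _ tab).
  by move: es; rewrite ll et => -[].
have mono : monotone_on (fun s => (c.2 (l s)).1) a b.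
  left=> s t as_ st tb.
  have sab : a <= s <= b by rewrite as_ (le_trans st tb).
  have tab : a <= t <= b by rewrite tb (le_trans as_ st).
  have [_ _ ->] := hl _ (sub1 _ sab).
  by have [_ _ ->] := hl _ (sub1 _ tab).
have av : half_avoiding (fun s => cell k (gam s)) a b.
  apply: (plaque_half_avoiding (y0 := y0) ac r01 kr kd) mono => s sab.
  have [h1 h2 h3] := hgam _ (sub _ sab); split => //.
    by rewrite h3 andbT; apply: hu; case/andP: sab => -> ->.
  by have [_ _ ->] := hl _ (sub1 _ sab).
have av' : half_avoiding (fun s => cell k (twist k 1 (gam s))) a b.
  apply: (plaque_half_avoiding (y0 := (c'.2 (l a)).2) ac' r01 kr kd) mono' => s sab.
  have [h1 h2 h3] := hgam _ (sub _ sab); split => //.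
  - by apply: continuous_comp => //; exact: continuous_twist.
  - exact: lE.
  - by rewrite enorm_twist h3 andbT; apply: hu; case/andP: sab => -> ->.
  - exact: c'const.
have := @twisted_not_half_avoiding R (fun s => cell k (gam s))
  (fun s => 1 * angle k (cell k (gam s))) a b ab.
have cz s : a <= s <= b -> {for s, continuous (fun s => cell k (gam s))}.
  by move=> /sub/hgam[cs _ _]; apply: continuous_comp => //; exact: continuous_cell.
apply=> //.
- move=> s sab; rewrite /continuous_at; apply: cvgM; first exact: cvg_cst.
  by apply: (continuous_comp (cz _ sab)); exact: continuous_angle.
- move=> s sab; apply: lt_le_trans (hu _ _); first by rewrite divr_gt0.
  by case/andP: sab => -> ->.
- rewrite !mul1r /angle -!/(u _) ub ua !max_r ?subr_ge0 //; first last.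
  + exact: ltW.
  + by rewrite ler_pdivrMr // mul1r; apply: le_trans (ltW r1) _; rewrite ler1n.
  apply: le_trans (lerD (lexx _) turns) _.
  by rewrite -mulrDr; apply: ler_wpM2l => //; lra.
- have e : (fun s => cell k (twist k 1 (gam s))) =
      (fun s => rot (1 * angle k (cell k (gam s))) (cell k (gam s))).
    by apply/funext => s; rewrite uncellK.
  by rewrite -e.
Qed.

End Conflict.

(** * Uncountably many seams *)
Section Pigeonhole.
Variable R : realType.
Implicit Types (x : nat -> bool).

(** Cantor's diagonal argument. *)
Lemma uncountable_bits : ~ countable [set: nat -> bool].
Proof.
move=> /countable_injP[f finj].
pose x n := ~~ `[< exists y : nat -> bool, f y = n /\ y n >].
have [xf|xf] := boolP (x (f x)).
  move: (xf); rewrite {1}/x => /asboolP; apply; by exists x.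
move: (xf); rewrite {1}/x negbK => /asboolP[y [fy yx]].
have e : y = x by apply: finj fy; rewrite inE.
by move: yx; rewrite e (negbTE xf).
Qed.

(** Each seam meets only the chart of its own sequence, and finitely many charts
    cover K. *)
Lemma finite_seams (K : set (moore R)) : compact K ->
  finite_set [set x | K (Seam x (one_nneg R))].
Proof.
rewrite compact_cover => /(_ _ setT (fun x => [set p | in_chart x p])).
case=> [x _|p Kp|D _ KD]; first exact: open_in_chart.
  case: p Kp => [z|x a] _; first by exists (fun=> false).
  by exists x.
apply: (sub_finite_set _ (finite_fset D)) => x /= /KD[y Dy] /= ->.
exact: Dy.
Qed.

(** A rank from which the discs are flat enough, and twisted enough, for the
    constants r = 1 / (n + 2) and d = 1 / (n' + 1). *)
Definition depth (n n' : nat) : nat :=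
  (n + n' + Num.truncn (pi *+ 8 * n.+2%:R : R)).+2.

Lemma depthP (n n' k : nat) : (depth n n' <= k)%N ->
  [/\ expR (- k%:R) <= n.+2%:R^-1 :> R, expR (- k%:R) <= n'.+1%:R^-1 :> R
    & pi *+ 4 <= k%:R * (n.+2%:R^-1 / 2) :> R].
Proof.
move=> nk.
have ek (m : nat) : (m <= k)%N -> expR (- k%:R) <= m.+1%:R^-1 :> R.
  move=> mk; rewrite expRN lef_pV2 ?posrE ?expR_gt0 //.
  apply: le_trans (expR_ge1Dx _); rewrite -natr1 addrC lerD2l ler_nat //.
split.
- by apply: ek; apply: leq_trans nk; rewrite /depth ltnS leqW // -addnA leq_addr.
- apply: ek; apply: leq_trans nk; rewrite /depth -addnA addnCA.
  by do 2 apply: leqW; exact: leq_addr.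
have h : pi *+ 8 * n.+2%:R <= k%:R :> R.
  apply: ltW; apply: (lt_le_trans (truncnS_gt _)); rewrite ler_nat.
  by apply: leq_trans nk; rewrite /depth leqW // ltnS leq_addl.
rewrite mulrA ler_pdivlMr // ler_pdivlMr //; apply: le_trans h.
by rewrite ler_pM2r // mulr_natr -mulrnA.
Qed.

(** The label of a sequence consists of the constants of an adapted chart and of
    the terms of index below the depth of these constants. Two sequences with
    the same label would conflict, and there are only countably many labels. *)
Lemma no_foliation (K : set (moore R)) : compact K ->
  ~ admits_foliation1 R 1 (~` K).
Proof.
move=> cK [F [Fch Fcov Fcc _]]; apply: uncountable_bits.
pose A := [set x | K (Seam x (one_nneg R))].
pose label x (q : nat * nat * seq bool) := exists c,
  [/\ F c, adapted x c q.1.1.+2%:R^-1 q.1.2.+1%:R^-1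
    & q.2 = mkseq x (depth q.1.1 q.1.2)].
have labelled x : ~ A x -> exists q, label x q.
  move=> nA; have [c Fc cx] := Fcov _ nA.
  have [n [n' ad]] := adapted_exists (Fch _ Fc).1 cx.
  by exists (n, n', mkseq x (depth n n')), c.
have label_inj x x' q : label x q -> label x' q -> x = x'.
  case: q => [[n n'] s] [c [Fc ad /= es]] [c' [Fc' ad' /= es']].
  apply: contrapT => /first_difference[k [xx' xk]].
  have kd : (depth n n' <= k)%N.
    rewrite leqNgt; apply/negP => kd; move/negP: xk; apply.
    have := congr1 (fun s => nth false s k) (etrans (esym es) es').
    by rewrite !nth_mkseq // => ->.
  have [h1 h2 h3] := depthP kd.
  have r01 : 0 < (n.+2%:R^-1 : R) < 1.
    by rewrite invr_gt0 ltr0n invf_lt1 // ltr1n.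
  case xkE : (x k) xk; case x'kE : (x' k) => // _.
    exact: (twist_conflict (Fch _ Fc).1 (Fch _ Fc').1 (Fcc _ _ Fc Fc') ad ad'
      r01 h1 h2 h3 xx' xkE x'kE).
  apply: (twist_conflict (Fch _ Fc').1 (Fch _ Fc).1 (Fcc _ _ Fc' Fc) ad' ad
      r01 h1 h2 h3 _ x'kE xkE).
  by move=> j jk; rewrite xx'.
have -> : [set: nat -> bool] = \bigcup_(b in [set: bool]) (if b then A else ~` A).
  apply/seteqP; split=> x _ //.
  by have [Ax|nAx] := pselect (A x); [exists true|exists false].
apply: bigcup_countable => [|[] _]; first exact: countableP.
  exact/finite_set_countable/finite_seams.
have [q hq] : {q & forall x, ~ A x -> label x (q x)}.
  apply: (@choice _ _ (fun x q => ~ A x -> label x q)) => x.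
  have [Ax|/labelled[q hq]] := pselect (A x); last by exists q.
  by exists (0%N, 0%N, [::]).
apply/countable_injP; exists (pickle \o q) => x x'; rewrite !inE => nx nx'.
move=> /(pcan_inj pickleK) e; apply: (label_inj x x' (q x)); first exact: hq.
by rewrite e; exact: hq.
Qed.

End Pigeonhole.

Local Close Scope ring_scope.

(* On a surface, a foliation of dimension 1 has codimension 1. *)
Theorem mainTheorem9 (R : realType) :
  exists M : topologicalType,
    [/\ surface R M, separable M, simply_connected R M
      & forall K : set M, compact K -> ~ admits_foliation1 R 1 (~` K)].
Proof.
exists (moore R); split.
- split; [exact: hausdorff_moore|exact: connected_moore|].
  exact: locally_euclidean_moore.
- exact: separable_moore.
- exact: simply_connected_moore.
- exact: no_foliation.
Qed.
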